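(* Let $A$ be a $C^*$-algebra. The following are equivalent: (i) $A$ is $\ell$-open. (ii) For every $C^*$-algebra $B$ and every ideal $I\subseteq B$, the natural map $\mathrm{Hom}(A,B)\to \mathrm{Hom}(A,B/I)$, $\phi\mapsto \pi_I\circ\phi$, is open. (iii) $A$ satisfies the conclusion of the Homotopy Lifting Theorem, and $\mathrm{Hom}(A,B)$ is locally path-connected for every $C^*$-algebra $B$.
   Context: Ideals of $C^*$-algebras are closed and two-sided; for an ideal $I$ of a $C^*$-algebra $B$, $\pi_I:B\to B/I$ is the quotient map. $\mathrm{Hom}(A,B)$ is the space of all $^*$-homomorphisms $A\to B$ (not necessarily unital) with the point-norm topology: a neighbourhood base at $\phi$ is given by the sets $\{\psi: \|\psi(a)-\phi(a)\|<\epsilon\ \forall a\in\mathcal F\}$, over finite $\mathcal F\subset A$ and $\epsilon>0$. A $^*$-homomorphism $\phi:A\to B/I$ is liftable if $\phi=\pi_I\circ\overline\phi$ for some $^*$-homomorphism $\overline\phi:A\to B$ (a lift of $\phi$). $A$ is $\ell$-open if for every $C^*$-algebra $B$ and ideal $I$ of $B$, the set of liftable $^*$-homomorphisms $\{\pi_I\circ\phi:\phi\in\mathrm{Hom}(A,B)\}$ is open in $\mathrm{Hom}(A,B/I)$. $A$ satisfies the conclusion of the Homotopy Lifting Theorem if: for every $C^*$-algebra $B$, every ideal $I$ of $B$, every point-norm continuous path $(\varphi_t)_{t\in[0,1]}$ of $^*$-homomorphisms $A\to B/I$, and every $^*$-homomorphism $\overline{\varphi_0}:A\to B$ lifting $\varphi_0$,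 there is a point-norm continuous path $(\overline{\varphi_t})_{t\in[0,1]}$ of $^*$-homomorphisms $A\to B$ starting at the given $\overline{\varphi_0}$ such that $\overline{\varphi_t}$ is a lift of $\varphi_t$ for all $t\in[0,1]$. *)

(* Defs.v *)
From HB Require Import structures.
From mathcomp Require Import all_boot all_order all_algebra.
From mathcomp Require Import generic_quotient ring_quotient complex.
From mathcomp Require Import boolp classical_sets functions reals topology.
From mathcomp Require Import normedtype sequences lra.

Set Implicit Arguments.
Unset Strict Implicit.
Unset Printing Implicit Defensive.

Import Order.TTheory GRing.Theory Num.Theory.
Import numFieldNormedType.Exports.

Local Open Scope classical_set_scope.
Local Open Scope ring_scope.
Local Open Scope complex_scope.

(* The scalar field is R[i] with R : realType.  As everywhere in
   MathComp-Analysis, the norm of a normedModType R[i] takes its values in the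
   scalar field; rnorm below is the same norm read in R.  C*-algebras are not
   assumed unital, and the zero algebra is allowed. *)

Reserved Notation "x ** y" (at level 40, left associativity).

HB.mixin Record isCStarAlgebra (R : realType) B
    & CompleteNormedModule R[i] B := {
  cmul : B -> B -> B;
  cstar : B -> B;
  cmulA : forall x y z, cmul x (cmul y z) = cmul (cmul x y) z;
  cmulDl : forall x y z, cmul (x + y) z = cmul x z + cmul y z;
  cmulDr : forall x y z, cmul x (y + z) = cmul x y + cmul x z;
  cmulZl : forall (a : R[i]) x y, cmul (a *: x) y = a *: cmul x y;
  cmulZr : forall (a : R[i]) x y, cmul x (a *: y) = a *: cmul x y;
  cstarK : involutive cstar;
  cstarD : forall x y, cstar (x + y) = cstar x + cstar y;
  cstarZ : forall (a : R[i]) x, cstar (a *: x) = Num.conj a *: cstar x;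
  cstarM : forall x y, cstar (cmul x y) = cmul (cstar y) (cstar x);
  cnormM : forall x y, `|cmul x y| <= `|x| * `|y|;
  cnorm_star : forall x, `|cmul (cstar x) x| = `|x| ^+ 2
}.

#[short(type="cstarType")]
HB.structure Definition CStarAlgebra (R : realType) :=
  {B of CompleteNormedModule R[i] B & isCStarAlgebra R B}.

Notation "x ** y" := (cmul x y) : ring_scope.

Section CStarTheory.
Variables (R : realType) (B : cstarType R).
Implicit Types (x y z h e w : B) (a : R[i]).

Definition rnorm x : R := complex.Re `|x|.

Lemma rnormE x : `|x| = (rnorm x)%:C.
Proof. by rewrite /rnorm RRe_real// ger0_real. Qed.

Lemma rnorm_ge0 x : 0 <= rnorm x.
Proof.
by have := normr_ge0 x; rewrite rnormE -(rmorph0 (real_complex R)) lecR.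
Qed.

Lemma rnormD x y : rnorm (x + y) <= rnorm x + rnorm y.
Proof.
by rewrite -lecR [leRHS]rmorphD/= -!rnormE ler_normD.
Qed.

Lemma rnormN x : rnorm (- x) = rnorm x.
Proof. by rewrite /rnorm normrN. Qed.

Lemma rnormB x y : rnorm (x - y) <= rnorm x + rnorm y.
Proof. by rewrite -(rnormN y) rnormD. Qed.

Lemma rnormC x y : rnorm (x - y) = rnorm (y - x).
Proof. by rewrite -rnormN opprB. Qed.

Lemma rnormM x y : rnorm (x ** y) <= rnorm x * rnorm y.
Proof. by rewrite -lecR [leRHS]rmorphM/= -!rnormE cnormM. Qed.

Lemma rnorm0 : rnorm 0 = 0.
Proof. by rewrite /rnorm normr0. Qed.

Lemma rnorm0_eq0 x : rnorm x = 0 -> x = 0.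
Proof. by move=> x0; apply/normr0_eq0; rewrite rnormE x0. Qed.

Lemma rnormZ (k : R) x : 0 <= k -> rnorm (k%:C *: x) = k * rnorm x.
Proof.
move=> k0; apply: complexI; rewrite rmorphM -!rnormE normrZ.
by rewrite normc_def/= expr0n addr0 sqrtr_sqr ger0_norm// rnormE.
Qed.

Lemma rnormZi x : rnorm ('i%R *: x) = rnorm x.
Proof. by apply: complexI; rewrite -!rnormE normrZ normCi mul1r. Qed.

Lemma rnorm_half x y : x + x = y -> rnorm x <= rnorm y / 2.
Proof.
move=> <-; rewrite -mulr2n -scaler_nat -(rmorph_nat (real_complex R)).
by rewrite rnormZ//; lra.
Qed.

Lemma cmul0r x : 0 ** x = 0.
Proof. by apply: (addIr (0 ** x)); rewrite -cmulDl !add0r. Qed.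

Lemma cmulr0 x : x ** 0 = 0.
Proof. by apply: (addIr (x ** 0)); rewrite -cmulDr !add0r. Qed.

Lemma cmulNl x y : (- x) ** y = - (x ** y).
Proof. by apply: (addIr (x ** y)); rewrite -cmulDl !addNr cmul0r. Qed.

Lemma cmulNr x y : x ** (- y) = - (x ** y).
Proof. by apply: (addIr (x ** y)); rewrite -cmulDr !addNr cmulr0. Qed.

Lemma cmulBl x y z : (x - y) ** z = x ** z - y ** z.
Proof. by rewrite cmulDl cmulNl. Qed.

Lemma cmulBr x y z : x ** (y - z) = x ** y - x ** z.
Proof. by rewrite cmulDr cmulNr. Qed.

Lemma cstar0 : cstar (0 : B) = 0.
Proof. by apply: (addIr (cstar 0)); rewrite -cstarD !add0r. Qed.

Lemma cstarN x : cstar (- x) = - cstar x.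
Proof. by apply: (addIr (cstar x)); rewrite -cstarD !addNr cstar0. Qed.

Lemma cstarB x y : cstar (x - y) = cstar x - cstar y.
Proof. by rewrite cstarD cstarN. Qed.

Lemma rnorm_starM x : rnorm (cstar x ** x) = rnorm x ^+ 2.
Proof. by apply: complexI; rewrite rmorphXn/= -!rnormE cnorm_star. Qed.

Lemma rnorm_star x : rnorm (cstar x) = rnorm x.
Proof.
have le y : rnorm y <= rnorm (cstar y).
  have [y0|/negP y0] := eqVneq (rnorm y) 0; first by rewrite y0 rnorm_ge0.
  have yp : 0 < rnorm y by rewrite lt_neqAle eq_sym rnorm_ge0 andbT; apply/negP.
  by rewrite -(ler_pM2r yp) -expr2 -rnorm_starM rnormM.
by apply/le_anti; rewrite le andbT -[in leRHS](cstarK x) le.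
Qed.

Lemma rnorm_Mstar x : rnorm (x ** cstar x) = rnorm x ^+ 2.
Proof. by rewrite -{1}(cstarK x) rnorm_starM rnorm_star. Qed.

End CStarTheory.

Section CStarComplete.
Variables (R : realType) (B : cstarType R).
Implicit Types (x y z h e w : B).

Lemma gt0_complexE (e : R[i]) : 0 < e -> exists2 r : R, 0 < r & e = r%:C.
Proof.
move=> e0; exists (complex.Re e); last by rewrite RRe_real// gtr0_real.
by have := e0; rewrite -{1}(RRe_real (gtr0_real e0)) -(rmorph0 (real_complex R)) ltcR.
Qed.

Lemma nbhs_rnormP x (A : set B) :
  nbhs x A <-> exists2 r : R, 0 < r & forall y, rnorm (x - y) < r -> A y.
Proof.
rewrite -nbhs_ballE; split=> [[e /= /gt0_complexE[r r0 ->]] xA|[r r0 xA]].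
  exists r => // y xy; apply: xA.
  by rewrite -ball_normE /ball_/= rnormE ltcR.
exists r%:C => /=; first by rewrite -(rmorph0 (real_complex R)) ltcR.
by move=> y; rewrite -ball_normE /ball_/= rnormE ltcR; exact: xA.
Qed.

Lemma geo_small (C q r : R) : 0 <= q < 1 -> 0 < r ->
  exists N, C * q ^+ N < r.
Proof.
move=> /andP[q0 q1] r0.
have /cvgrPdist_lt /(_ _ r0) [N _ /(_ N (leqnn N))] :=
  @cvg_geometric R C q ltac:(by rewrite ger0_norm).
by rewrite /= sub0r normrN => /(le_lt_trans (ler_norm _)); exists N.
Qed.

Lemma geo_cvg (u : nat -> B) (C q : R) : 0 <= C -> 0 <= q < 1 ->
  (forall n, rnorm (u n.+1 - u n) <= C * q ^+ n) ->
  exists l, forall n, rnorm (l - u n) <= C * q ^+ n / (1 - q).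
Proof.
move=> C0 /[dup] q01 /andP[q0 q1] uq.
have p0 : 0 < 1 - q by rewrite subr_gt0.
have K0 n : 0 <= C * q ^+ n by rewrite mulr_ge0// exprn_ge0.
have d n m : rnorm (u (n + m)%N - u n) <= C * q ^+ n / (1 - q).
  rewrite ler_pdivlMr//; apply: (@le_trans _ _ (C * q ^+ n * (1 - q ^+ m))).
    elim: m => [|m IH]; first by rewrite addn0 subrr rnorm0 mul0r expr0 subrr mulr0.
    have -> : u (n + m.+1)%N - u n = (u (n + m).+1%N - u (n + m)%N) + (u (n + m)%N - u n).
      by rewrite addrA subrK addnS.
    have h1 : rnorm (u (n + m).+1%N - u (n + m)%N + (u (n + m)%N - u n)) * (1 - q)
        <= C * q ^+ (n + m) * (1 - q) + C * q ^+ n * (1 - q ^+ m).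
      apply: le_trans (lerD _ IH); last by apply: ler_wpM2r (ltW p0) _ _ (uq _).
      by rewrite -mulrDl; apply: ler_wpM2r (ltW p0) _ _ (rnormD _ _).
    apply: (le_trans h1); rewrite exprD exprS.
    set a := q ^+ n; set b := q ^+ m; nra.
  by rewrite -[leRHS]mulr1 ler_wpM2l// gerBl exprn_ge0.
have cu : cvg (u @ \oo).
  apply/cauchy_cvgP/cauchy_exP => _/= /gt0_complexE[r r0 ->].
  have [N CN] := geo_small (C / (1 - q)) q01 r0.
  exists (u N), N => // m /= Nm.
  rewrite -ball_normE /ball_/= rnormE ltcR rnormC -(subnKC Nm).
  by rewrite (le_lt_trans (d _ _))// mulrAC.
exists (lim (u @ \oo)) => n; apply/ler_addgt0Pr => r r0.
have /cu : nbhs (lim (u @ \oo)) [set y | rnorm (lim (u @ \oo) - y) < r].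
  by apply/nbhs_rnormP; exists r.
case=> N _ /(_ (n + N)%N (leq_addl _ _)) /= uN.
rewrite -[X in rnorm X](subrKA (u (n + N)%N)) addrC.
by rewrite (le_trans (rnormD _ _))// lerD// ltW.
Qed.

Lemma quasiB w a b : (w - w ** a) - (w - w ** b) = - (w ** (a - b)).
Proof. by rewrite cmulBr [- (w - _)]opprB addrC subrKA [RHS]opprB. Qed.

Lemma quasi_unique w z z' : rnorm w < 1 ->
  forall c, z = c - w ** z -> z' = c - w ** z' -> z = z'.
Proof.
move=> w1 c zE z'E; apply/eqP; rewrite -subr_eq0; apply/eqP/rnorm0_eq0.
have dE : z - z' = - (w ** (z - z')).
  by rewrite {1}zE {1}z'E cmulBr opprB addrC subrKA [RHS]opprB.
have := rnormM w (z - z'); rewrite -rnormN -dE.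
have := rnorm_ge0 (z - z'); set n := rnorm (z - z'); nra.
Qed.

Lemma quasi_exists w : rnorm w < 1 -> exists z, z = w - w ** z.
Proof.
move=> w1; pose u n := iter n (fun z => w - w ** z) 0.
have q01 : 0 <= rnorm w < 1 by rewrite rnorm_ge0.
have uw n : rnorm (u n.+1 - u n) <= rnorm w * rnorm w ^+ n.
  elim: n => [|n IH]; first by rewrite /u/= cmulr0 !subr0 expr0 mulr1.
  have -> : u n.+2 - u n.+1 = - (w ** (u n.+1 - u n)) by exact: quasiB.
  rewrite rnormN (le_trans (rnormM _ _))// exprS.
  by rewrite ler_wpM2l// rnorm_ge0.
have [z zu] := geo_cvg (rnorm_ge0 w) q01 uw.
exists z; apply/eqP; rewrite -subr_eq0; apply/eqP/rnorm0_eq0/le_anti.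
rewrite rnorm_ge0 andbT; apply/ler_addgt0Pr => r r0; rewrite add0r.
have [N /ltW CN] := geo_small (2 * rnorm w / (1 - rnorm w)) q01 r0.
apply: le_trans CN.
have -> : z - (w - w ** z) = (z - u N.+1) + w ** (z - u N).
  rewrite (_ : u N.+1 = w - w ** u N)// cmulBr; move: (w ** z) (w ** u N) => a b.
  by rewrite !opprB addrC [RHS]addrC [RHS]addrCA subrKA [RHS]addrC.
have h1 := zu N.+1; have h2 := zu N; have h3 := rnormM w (z - u N).
apply: (le_trans (rnormD _ _)); apply: (le_trans (lerD h1 h3)).
have h4 := ler_wpM2l (rnorm_ge0 w) h2.
apply: (le_trans (lerD (lexx _) h4)); rewrite exprS.
set b := rnorm w ^+ N; set c := (1 - rnorm w)^-1.
have h5 : 0 <= (1 - rnorm w) * (rnorm w * b * c).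
  have p0 : 0 <= 1 - rnorm w by rewrite subr_ge0 ltW.
  by rewrite !mulr_ge0// ?rnorm_ge0 ?exprn_ge0 ?invr_ge0// rnorm_ge0.
nra.
Qed.

End CStarComplete.

Section Resolvent.
Variables (R : realType) (B : cstarType R).
Implicit Types (x y z h e w : B).

Lemma conjC_real (r : R) : Num.conj (r%:C) = r%:C.
Proof. by apply: conj_Creal; apply/complex_realP; exists r. Qed.

Lemma cstarZr (r : R) x : cstar (r%:C *: x) = r%:C *: cstar x.
Proof. by rewrite cstarZ conjC_real. Qed.

(* With s := 1 - e, the hypotheses say that s = (1 + h^2)^-1 in the
   unitization.  Since (1 +- ih)s are adjoint to each other, with product s, the
   norm n of s satisfies n^2 <= n. *)
Lemma resolvent_norm h e : cstar h = h -> cstar e = e -> e ** h = h ** e ->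
  e + h ** h ** e = h ** h ->
  (forall y, rnorm (y - y ** e) <= rnorm y) /\
  (forall y, rnorm (y ** h - y ** h ** e) <= rnorm y).
Proof.
move=> hs es eh eE; pose s y := y - y ** e.
have tE y : y ** h - y ** h ** e = s y ** h.
  by rewrite /s cmulBl -!cmulA eh.
have key (k : R[i]) y : Num.conj k = - k -> k * k = -1 ->
    rnorm (s y + k *: (s y ** h)) ^+ 2 <= rnorm (s y) * rnorm y.
  move=> ks kk; rewrite -rnorm_Mstar cstarD cstarZ cstarM hs ks.
  have -> : (s y + k *: (s y ** h)) ** (cstar (s y) + - k *: (h ** cstar (s y)))
     = s y ** (cstar (s y) + h ** h ** cstar (s y)).
    rewrite cmulDl !cmulDr !cmulZr !cmulZl scalerA mulNr kk opprK scale1r.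
    by rewrite scaleNr !cmulA addrA subrK.
  suff -> : cstar (s y) + h ** h ** cstar (s y) = cstar y.
    by rewrite (le_trans (rnormM _ _))// rnorm_star.
  rewrite /s cstarB cstarM es cmulBr [h ** h ** (e ** _)]cmulA.
  by rewrite addrACA -opprD -cmulDl eE addrK.
have ki := @conjCi R[i]; have ii := @sqrCi R[i]; rewrite expr2 in ii.
have kNi : Num.conj (- 'i%R : R[i]) = - - 'i%R by rewrite rmorphN/= ki.
have iiN : (- 'i%R : R[i]) * - 'i%R = -1 by rewrite mulrNN ii.
have le y : rnorm (s y) <= rnorm y /\ rnorm (s y ** h) <= rnorm y.
  have k1 := key _ y ki ii; have k2 := key _ y kNi iiN.
  have := @rnorm_half _ _ (s y) _ (erefl _); have := @rnorm_half _ _ ('i%R *: (s y ** h)) _ (erefl _).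
  rewrite rnormZi.
  have -> : s y + s y = (s y + 'i%R *: (s y ** h)) + (s y + - 'i%R *: (s y ** h)).
    by rewrite scaleNr [RHS]addrACA subrr addr0.
  have -> : 'i%R *: (s y ** h) + 'i%R *: (s y ** h) =
     (s y + 'i%R *: (s y ** h)) - (s y + - 'i%R *: (s y ** h)).
    by rewrite scaleNr opprB [RHS]addrC subrKA.
  have := rnormD (s y + 'i%R *: (s y ** h)) (s y + - 'i%R *: (s y ** h)).
  have := rnormB (s y + 'i%R *: (s y ** h)) (s y + - 'i%R *: (s y ** h)).
  move: k1 k2; set u := s y + _; set v := s y + _.
  have := rnorm_ge0 u; have := rnorm_ge0 v; have := rnorm_ge0 y.
  have := rnorm_ge0 (s y); have := rnorm_ge0 (s y ** h).
  move: (rnorm u) (rnorm v) (rnorm y) (rnorm (s y)) (rnorm (s y ** h)).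
  move: (rnorm (u + v)) (rnorm (u - v)) => p q a b n c d d0 c0 n0 b0 a0 k1 k2 hq hp hd hc.
  have sq : ((a + b) / 2) ^+ 2 <= c * n.
    have := sqr_ge0 (a - b); rewrite !expr2 in k1 k2 *; lra.
  have c_le : c <= (a + b) / 2 by lra.
  have d_le : d <= (a + b) / 2 by lra.
  have cn : c <= n.
    rewrite leNgt; apply/negP => nc.
    have : c ^+ 2 <= ((a + b) / 2) ^+ 2 by rewrite ler_sqr ?nnegrE//; lra.
    rewrite expr2; nra.
  split=> //.
  have : d ^+ 2 <= ((a + b) / 2) ^+ 2 by rewrite ler_sqr ?nnegrE//; lra.
  move=> /le_trans/(_ sq) d2.
  rewrite -ler_sqr ?nnegrE// (le_trans d2)// expr2 ler_wpM2r//.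
by split=> y; [case: (le y)|rewrite tE; case: (le y)].
Qed.

Lemma quasi_comm w z c : rnorm w < 1 -> z = w - w ** z ->
  c ** w = w ** c -> c ** z = z ** c.
Proof.
move=> w1 zE cw; apply: (@quasi_unique _ _ w _ _ w1 (w ** c)).
  by rewrite {1}zE cmulBr cw cmulA cw -cmulA.
by rewrite {1}zE cmulBl -cmulA.
Qed.

Lemma quasi_sa w z : rnorm w < 1 -> z = w - w ** z ->
  cstar w = w -> cstar z = z.
Proof.
move=> w1 zE ws; apply: (@quasi_unique _ _ w _ _ w1 w) => //.
have wz : w ** z = z ** w by apply: quasi_comm zE _.
by rewrite {1}zE cstarB wz cstarM ws.
Qed.

Lemma resolvent_exists h : cstar h = h ->
  exists e, [/\ cstar e = e, e ** h = h ** e & e + h ** h ** e = h ** h].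
Proof.
move=> hs.
have [N hN] : exists N : nat, rnorm (h ** h) < N.+1%:R.
  exists (Num.bound (rnorm (h ** h))).
  rewrite (lt_trans (archi_boundP (rnorm_ge0 _)))// ltr_nat//.
pose t (n : nat) : R := n%:R / N.+1%:R.
suff [e [es eh eE]] : exists e, [/\ cstar e = e, e ** h = h ** e &
    e + (t N.+1)%:C *: (h ** h ** e) = (t N.+1)%:C *: (h ** h)].
  by exists e; move: eE; rewrite /t divff ?pnatr_eq0// !scale1r.
elim: {1 2}N.+1 => [|n [e [es eh eE]]].
  exists 0; rewrite cstar0 cmul0r !cmulr0 /t mul0r.
  by split=> //; rewrite !scale0r addr0.
have t0 : 0 <= t n by rewrite divr_ge0.
have [b1 _] : (forall y, rnorm (y - y ** e) <= rnorm y) /\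
  (forall y, rnorm (y ** ((Num.sqrt (t n))%:C *: h) - y ** ((Num.sqrt (t n))%:C *: h) ** e) <= rnorm y).
  apply: resolvent_norm => //; first by rewrite cstarZr hs.
    by rewrite cmulZr cmulZl eh.
  by rewrite cmulZl cmulZr scalerA -rmorphM -expr2 sqr_sqrtr// cmulZl.
pose d : R := N.+1%:R^-1; have d0 : 0 <= d by rewrite invr_ge0.
pose w := d%:C *: (h ** h) - d%:C *: (h ** h) ** e.
have w1 : rnorm w < 1.
  rewrite (le_lt_trans (b1 _))// rnormZ// /d mulrC ltr_pdivrMr ?ltr0n//.
  by rewrite mul1r.
have [z zE] := quasi_exists w1.
have ehh : e ** (h ** h) = h ** h ** e by rewrite cmulA eh -cmulA eh cmulA.
have ew : e ** w = w ** e.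
  by rewrite /w cmulBr cmulBl cmulZl !cmulZr !cmulZl ehh cmulA ehh.
have hw : h ** w = w ** h.
  by rewrite /w cmulBr cmulBl cmulZl !cmulZr !cmulZl -!cmulA eh.
have ws : cstar w = w.
  by rewrite /w cmulZl cstarB !cstarZr !cstarM hs es ehh.
have zs := quasi_sa w1 zE ws.
have ez := quasi_comm w1 zE ew; have hz := quasi_comm w1 zE hw.
exists (e + z - e ** z); split.
- by rewrite cstarB cstarD cstarM es zs ez.
- by rewrite !(cmulBl, cmulDl, cmulBr, cmulDr) eh hz cmulA -eh -!cmulA hz.
have -> : t n.+1 = t n + d by rewrite /t /d -addn1 natrD mulrDl mul1r.
pose a := (t n)%:C *: (h ** h); pose p := d%:C *: (h ** h).
have {}eE : e + a ** e = a by rewrite /a cmulZl.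
have zE' : z + (p - p ** e) ** z = p - p ** e by rewrite {1}zE subrK.
have -> : (t n + d)%:C *: (h ** h) = a + p by rewrite rmorphD scalerDl.
have -> x : (t n + d)%:C *: (h ** h ** x) = a ** x + p ** x.
  by rewrite /a /p !cmulZl rmorphD scalerDl.
have fa : (e + z - e ** z) + a ** (e + z - e ** z) = a + z.
  rewrite cmulBr cmulDr addrACA -opprD cmulA -cmulDl eE addrACA eE.
  by rewrite addrA addrK.
have fp : p ** (e + z - e ** z) = p ** e + (p - p ** e) ** z.
  by rewrite cmulBr cmulDr cmulBl cmulA addrA.
by rewrite addrA fa fp -addrA [z + _]addrCA zE' [p ** e + _]addrC subrK.
Qed.

End Resolvent.

(* Self-adjointness is not required: it is a consequence, see ideal_star. *)
Record closedIdeal (R : realType) (B : cstarType R) := ClosedIdeal {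
  ideal_set : set B;
  ideal0 : ideal_set 0;
  idealD : forall x y, ideal_set x -> ideal_set y -> ideal_set (x + y);
  idealZ : forall (a : R[i]) x, ideal_set x -> ideal_set (a *: x);
  idealMl : forall x y, ideal_set y -> ideal_set (x ** y);
  idealMr : forall x y, ideal_set x -> ideal_set (x ** y);
  ideal_closed : closed ideal_set
}.

Section ClosedIdeal.
Variables (R : realType) (B : cstarType R) (I : closedIdeal B).
Implicit Types (x y z h e w : B).

Lemma idealN x : ideal_set I x -> ideal_set I (- x).
Proof. by rewrite -scaleN1r; exact: idealZ. Qed.

Lemma idealB x y : ideal_set I x -> ideal_set I y -> ideal_set I (x - y).
Proof. by move=> Ix Iy; apply: idealD => //; exact: idealN. Qed.

Lemma ideal_approx x : (forall r : R, 0 < r -> exists2 y, ideal_set I y & rnorm (x - y) < r) ->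
  ideal_set I x.
Proof.
move=> ax; apply: (@ideal_closed _ _ I) => A /nbhs_rnormP[r r0 xA].
by have [y Iy xy] := ax _ r0; exists y; split => //; exact: xA.
Qed.

Lemma ideal_unit x (r : R) : ideal_set I (cstar x ** x) -> 0 < r ->
  exists e, [/\ ideal_set I e, cstar e = e, forall y, rnorm (y - y ** e) <= rnorm y
              & rnorm (x - x ** e) <= r].
Proof.
move=> Ixx r0; pose m := r ^- 2.
have m0 : 0 < m by rewrite invr_gt0 exprn_gt0.
pose h := m%:C *: (cstar x ** x).
have Ih : ideal_set I h by exact: idealZ.
have hs : cstar h = h by rewrite cstarZr cstarM cstarK.
have [e [es eh eE]] := resolvent_exists hs.
have [b1 b2] := resolvent_norm hs es eh eE.
exists e; split => //.
  rewrite -(addrK (h ** h ** e) e) eE.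
  by apply: idealB; [exact: idealMl|do 2 apply: idealMr].
pose u := h - h ** e.
have us : cstar u = u by rewrite cstarB cstarM hs es eh.
have u1 : rnorm u <= 1.
  have : rnorm u ^+ 2 <= rnorm u.
    by rewrite -rnorm_starM us {2}/u cmulBr cmulA b2.
  have := rnorm_ge0 u; rewrite expr2; nra.
have : m * rnorm (x - x ** e) ^+ 2 <= 1.
  rewrite -rnorm_starM -rnormZ ?(ltW m0)// cstarB cstarM es.
  suff -> : m%:C *: ((cstar x - e ** cstar x) ** (x - x ** e)) = u - u ** e.
    exact: le_trans (b1 u) u1.
  rewrite -cmulZl scalerBr -cmulZr cmulBr cmulA.
  suff -> : (m%:C *: cstar x - e ** (m%:C *: cstar x)) ** x = u by [].
  by rewrite cmulBl -cmulA cmulZl eh.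
by rewrite /m mulrC ler_pdivrMr ?exprn_gt0// mul1r ler_sqr// nnegrE ?rnorm_ge0// ltW.
Qed.

Lemma ideal_star x : ideal_set I x -> ideal_set I (cstar x).
Proof.
move=> Ix; apply: ideal_approx => r r0.
have r20 : 0 < r / 2 by rewrite divr_gt0.
have [|e [Ie es _ xe]] := @ideal_unit (cstar x) (r / 2) _ r20.
  by rewrite cstarK; exact: idealMr.
exists (cstar x ** e); first exact: idealMl.
by rewrite (le_lt_trans xe)//; lra.
Qed.

End ClosedIdeal.

(* The boolean form of an ideal, as expected by MathComp's quotients. *)
Definition ideal_pred (R : realType) (B : cstarType R) (I : closedIdeal B) : {pred B} :=
  fun x => `[< ideal_set I x >].

Section IdealPred.
Variables (R : realType) (B : cstarType R) (I : closedIdeal B).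

Lemma ideal_predE x : (x \in ideal_pred I) = `[< ideal_set I x >].
Proof. by []. Qed.

Lemma ideal_pred_zmod : zmod_closed (ideal_pred I).
Proof.
split=> [|x y]; rewrite !ideal_predE; first by apply/asboolP; exact: ideal0.
by move=> /asboolP Ix /asboolP Iy; apply/asboolP; exact: idealB.
Qed.

HB.instance Definition _ := GRing.isZmodClosed.Build B (ideal_pred I) ideal_pred_zmod.

End IdealPred.

Section Quotient.
Variables (R : realType) (B : cstarType R) (I : closedIdeal B).

Definition cquot : Type := Quotient.quot (ideal_pred I).

HB.instance Definition _ := GRing.Zmodule.on cquot.

Definition cpi (x : B) : cquot := \pi_(Quotient.quot (ideal_pred I))%qT x.

Definition crepr (q : cquot) : B := repr q.

Lemma creprK q : cpi (crepr q) = q.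
Proof. exact: reprK. Qed.

Lemma cpiP x y : cpi x = cpi y <-> ideal_set I (x - y).
Proof.
split=> [/eqP|Ixy]; last apply/eqP.
  by rewrite -[_ == _]Quotient.idealrBE ideal_predE => /asboolP.
by rewrite -[_ == _]Quotient.idealrBE ideal_predE; apply/asboolP.
Qed.

Lemma cpi_rep x : ideal_set I (crepr (cpi x) - x).
Proof. by apply/cpiP; rewrite creprK. Qed.

Lemma cpiD x y : cpi (x + y) = cpi x + cpi y.
Proof. exact: (raddfD \pi_(Quotient.quot (ideal_pred I))%qT). Qed.

End Quotient.

Section QuotientNorm.
Variables (R : realType) (B : cstarType R) (I : closedIdeal B).
Local Notation Q := (cquot I).
Local Notation cpi := (@cpi R B I).
Implicit Types (x y z : B) (p q : Q).

Lemma cquotP (P : Q -> Prop) : (forall x, P (cpi x)) -> forall q, P q.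
Proof. by move=> PQ q; rewrite -(creprK q). Qed.

Definition cquot_scale (a : R[i]) q : Q := cpi (a *: crepr q).

Lemma cpi_scale a x : cquot_scale a (cpi x) = cpi (a *: x).
Proof. by apply/cpiP; rewrite -scalerBr; apply/idealZ/cpi_rep. Qed.

Lemma cquot_scalerA a b q :
  cquot_scale a (cquot_scale b q) = cquot_scale (a * b) q.
Proof. by elim/cquotP: q => x; rewrite !cpi_scale scalerA. Qed.

Lemma cquot_scale1r : left_id 1 cquot_scale.
Proof. by elim/cquotP => x; rewrite cpi_scale scale1r. Qed.

Lemma cquot_scalerDr : right_distributive cquot_scale +%R.
Proof.
move=> a; elim/cquotP => x; elim/cquotP => y.
by rewrite -cpiD !cpi_scale -cpiD scalerDr.
Qed.

Lemma cquot_scalerDl q : {morph cquot_scale^~ q : a b / a + b}.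
Proof.
by elim/cquotP: q => x a b; rewrite !cpi_scale -cpiD scalerDl.
Qed.

HB.instance Definition _ := GRing.Zmodule_isLmodule.Build R[i] Q
  cquot_scalerA cquot_scale1r cquot_scalerDr cquot_scalerDl.

Lemma cpiZ a x : cpi (a *: x) = a *: cpi x.
Proof. by rewrite -cpi_scale. Qed.

Lemma cpi0 : cpi 0 = 0.
Proof. by rewrite -(scale0r 0) cpiZ scale0r. Qed.

Lemma cpiB x y : cpi (x - y) = cpi x - cpi y.
Proof. by rewrite cpiD -scaleN1r cpiZ scaleN1r. Qed.

(* The quotient norm ||x + I|| = inf { ||y|| : y in x + I }. *)
Definition qnorm q : R := inf [set rnorm x | x in [set x | cpi x = q]].

Lemma qnorm_has_inf q : has_inf [set rnorm x | x in [set x | cpi x = q]].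
Proof.
split; first by exists (rnorm (crepr q)), (crepr q) => //=; exact: creprK.
by exists 0 => _ [x _ <-]; exact: rnorm_ge0.
Qed.

Lemma qnorm_le x : qnorm (cpi x) <= rnorm x.
Proof. by apply: ge_inf; [case: (qnorm_has_inf (cpi x))|exists x]. Qed.

Lemma qnorm_ge q (r : R) : (forall x, cpi x = q -> r <= rnorm x) -> r <= qnorm q.
Proof.
move=> rq; apply: lb_le_inf; first by case: (qnorm_has_inf q).
by move=> _ [x xq <-]; exact: rq.
Qed.

Lemma qnorm_ge0 q : 0 <= qnorm q.
Proof. by apply: qnorm_ge => x _; exact: rnorm_ge0. Qed.

Lemma qnorm_lift q (r : R) : qnorm q < r -> exists2 x, cpi x = q & rnorm x < r.
Proof.
rewrite -subr_gt0 => r0.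
have [_ [x xq <-]] := inf_adherent r0 (qnorm_has_inf q).
by rewrite addrC subrK; exists x.
Qed.

Definition qnormC q : R[i] := (qnorm q)%:C.

Lemma qnormCD p q : qnormC (p + q) <= qnormC p + qnormC q.
Proof.
rewrite /qnormC -rmorphD lecR; apply/ler_addgt0Pr => r r0.
have [|x <- xp] := @qnorm_lift p (qnorm p + r / 2); first lra.
have [|y <- yq] := @qnorm_lift q (qnorm q + r / 2); first lra.
by rewrite -cpiD (le_trans (qnorm_le _))// (le_trans (rnormD _ _))//; lra.
Qed.

Lemma rnormZc (a : R[i]) x : rnorm (a *: x) = complex.Re `|a| * rnorm x.
Proof.
apply: complexI; rewrite -rnormE normrZ rnormE rmorphM/=.
by rewrite RRe_real// ger0_real.
Qed.

Lemma qnormCZ a q : qnormC (a *: q) = `|a| * qnormC q.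
Proof.
have [->|a0] := eqVneq a 0.
  rewrite scale0r normr0 mul0r /qnormC; congr _%:C.
  apply/le_anti; rewrite qnorm_ge0 andbT.
  by rewrite -cpi0 (le_trans (qnorm_le _))// rnorm0.
have nE (b : R[i]) : `|b| = (complex.Re `|b|)%:C by rewrite RRe_real// ger0_real.
have n0 (b : R[i]) : 0 <= complex.Re `|b|.
  by rewrite -lecR -nE normr_ge0.
have le b (s : Q) : qnorm (b *: s) <= complex.Re `|b| * qnorm s.
  apply/ler_addgt0Pr => r r0.
  have k0 : 0 < complex.Re `|b| + 1 by have := n0 b; lra.
  have [|x <- xs] := @qnorm_lift s (qnorm s + r / (complex.Re `|b| + 1)).
    by rewrite ltrDl divr_gt0.
  rewrite -cpiZ (le_trans (qnorm_le _))// rnormZc.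
  apply: (le_trans (ler_wpM2l (n0 b) (ltW xs))).
  rewrite mulrDr lerD2l mulrA ler_pdivrMr// mulrC ler_wpM2l ?ltW//; lra.
rewrite /qnormC nE -rmorphM; congr _%:C; apply/le_anti; rewrite le/=.
have := le a^-1 (a *: q); rewrite scalerA mulVf// scale1r normfV.
have a1 : 0 < complex.Re `|a|.
  by rewrite -ltcR -nE normr_gt0.
have -> : complex.Re `|a|^-1 = (complex.Re `|a|)^-1.
  by apply: complexI; rewrite [in LHS]nE -fmorphV.
by rewrite mulrC ler_pdivlMr// mulrC.
Qed.

Lemma qnormC_eq0 q : qnormC q = 0 -> q = 0.
Proof.
move=> /complexI; elim/cquotP: q => x x0; rewrite -cpi0; apply/cpiP.
rewrite subr0; apply: ideal_approx => r r0.
have [|y /esym/cpiP Ixy yr] := @qnorm_lift (cpi x) r; first by rewrite x0.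
by exists (x - y) => //; rewrite opprB addrC subrK.
Qed.

HB.instance Definition _ := Lmodule_isNormed.Build R[i] Q
  qnormCD qnormCZ qnormC_eq0.

Lemma cquot_normE q : `|q| = (qnorm q)%:C. Proof. by []. Qed.

End QuotientNorm.

Section QuotientCStar.
Variables (R : realType) (B : cstarType R) (I : closedIdeal B).
Local Notation Q := (cquot I).
Local Notation cpi := (@cpi R B I).
Implicit Types (x y z : B) (p q : Q).

Lemma qnormC_sym p q : qnorm (p - q) = qnorm (q - p).
Proof. by apply: complexI; rewrite -!cquot_normE distrC. Qed.

Lemma qnorm_triangle p q s : qnorm (p - s) <= qnorm (p - q) + qnorm (q - s).
Proof. by rewrite -lecR rmorphD/= -!cquot_normE ler_distD. Qed.

Lemma cquot_complete (F : set_system Q) : ProperFilter F -> cauchy F -> cvg F.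
Proof.
move=> FF /cauchyP Fc.
have q01 : 0 <= (1 / 2 : R) < 1 by lra.
have g0 n : 0 < (1 / 2 : R) ^+ n by rewrite exprn_gt0// divr_gt0.
have /choice[c cF] : forall n, exists c, F (ball (c : Q) ((1 / 2 : R) ^+ n)%:C).
  by move=> n; apply: Fc; rewrite -(rmorph0 (real_complex R)) ltcR.
have bE p q (r : R) : ball p r%:C q = (qnorm (p - q) < r) :> Prop.
  by rewrite -ball_normE /ball_/= cquot_normE ltcR.
have cc n : qnorm (c n.+1 - c n) < 2 * (1 / 2) ^+ n.
  have [q []] := filter_ex (filterI (cF n) (cF n.+1)); rewrite !bE => h1 h2.
  have := qnorm_triangle (c n.+1) q (c n); rewrite qnormC_sym in h1.
  by have := g0 n; move: h2; rewrite exprS; lra.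
have /choice[d dP] : forall n, exists x,
    cpi x = c n.+1 - c n /\ rnorm x < 2 * (1 / 2) ^+ n.
  by move=> n; have [x] := qnorm_lift (cc n); exists x.
pose b n := crepr (c 0%N) + \sum_(i < n) d i.
have bc n : cpi (b n) = c n.
  elim: n => [|n IH]; first by rewrite /b big_ord0 addr0 creprK.
  by rewrite /b big_ord_recr/= addrA cpiD -/(b n) IH (dP n).1 addrC subrK.
have [l lb] : exists l, forall n, rnorm (l - b n) <= 2 * (1 / 2) ^+ n / (1 - 1 / 2).
  apply: geo_cvg => // n.
  have -> : b n.+1 = b n + d n by rewrite /b big_ord_recr/= addrA.
  rewrite addrC addKr.
  exact: ltW (dP n).2.
apply/cvg_ex; exists (cpi l); apply/cvg_ballP => _ /gt0_complexE[r r0 ->].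
have [N Nr] := geo_small 5 q01 r0.
apply: filterS (cF N) => q; rewrite !bE => cq.
have := qnorm_triangle (cpi l) (c N) q.
have := qnorm_le I (l - b N); rewrite cpiB bc.
have := lb N; rewrite ler_pdivlMr; last lra.
by move: cq Nr; set t := (1 / 2) ^+ N; lra.
Qed.

HB.instance Definition _ := Uniform_isComplete.Build Q cquot_complete.

Definition cquot_mul p q : Q := cpi (crepr p ** crepr q).

Definition cquot_star q : Q := cpi (cstar (crepr q)).

Lemma cpi_mul x y : cquot_mul (cpi x) (cpi y) = cpi (x ** y).
Proof.
apply/cpiP; rewrite -[X in ideal_set I X](subrKA (crepr (cpi x) ** y)).
rewrite -cmulBr -cmulBl; apply: idealD.
  by apply/idealMl/cpi_rep.
by apply/idealMr/cpi_rep.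
Qed.

Lemma cpi_star x : cquot_star (cpi x) = cpi (cstar x).
Proof. by apply/cpiP; rewrite -cstarB; apply/ideal_star/cpi_rep. Qed.

Lemma cquot_mulA p q s :
  cquot_mul p (cquot_mul q s) = cquot_mul (cquot_mul p q) s.
Proof.
elim/cquotP: p => x; elim/cquotP: q => y; elim/cquotP: s => z.
by rewrite !cpi_mul cmulA.
Qed.

Lemma cquot_mulDl p q s :
  cquot_mul (p + q) s = cquot_mul p s + cquot_mul q s.
Proof.
elim/cquotP: p => x; elim/cquotP: q => y; elim/cquotP: s => z.
by rewrite -cpiD !cpi_mul -cpiD cmulDl.
Qed.

Lemma cquot_mulDr p q s :
  cquot_mul p (q + s) = cquot_mul p q + cquot_mul p s.
Proof.
elim/cquotP: p => x; elim/cquotP: q => y; elim/cquotP: s => z.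
by rewrite -cpiD !cpi_mul -cpiD cmulDr.
Qed.

Lemma cquot_mulZl (a : R[i]) p q :
  cquot_mul (a *: p) q = a *: cquot_mul p q.
Proof.
elim/cquotP: p => x; elim/cquotP: q => y.
by rewrite -cpiZ !cpi_mul -cpiZ cmulZl.
Qed.

Lemma cquot_mulZr (a : R[i]) p q :
  cquot_mul p (a *: q) = a *: cquot_mul p q.
Proof.
elim/cquotP: p => x; elim/cquotP: q => y.
by rewrite -cpiZ !cpi_mul -cpiZ cmulZr.
Qed.

Lemma cquot_starK : involutive cquot_star.
Proof. by elim/cquotP => x; rewrite !cpi_star cstarK. Qed.

Lemma cquot_starD p q : cquot_star (p + q) = cquot_star p + cquot_star q.
Proof.
elim/cquotP: p => x; elim/cquotP: q => y.
by rewrite -cpiD !cpi_star -cpiD cstarD.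
Qed.

Lemma cquot_starZ (a : R[i]) q :
  cquot_star (a *: q) = Num.conj a *: cquot_star q.
Proof. by elim/cquotP: q => x; rewrite -cpiZ !cpi_star -cpiZ cstarZ. Qed.

Lemma cquot_starM p q :
  cquot_star (cquot_mul p q) = cquot_mul (cquot_star q) (cquot_star p).
Proof.
elim/cquotP: p => x; elim/cquotP: q => y.
by rewrite cpi_mul !cpi_star cpi_mul cstarM.
Qed.

Lemma qnorm_mul p q : qnorm (cquot_mul p q) <= qnorm p * qnorm q.
Proof.
have le (r : R) : 0 < r -> qnorm (cquot_mul p q) <= (qnorm p + r) * (qnorm q + r).
  move=> r0.
  have [|x <- xp] := @qnorm_lift _ _ _ p (qnorm p + r); first by rewrite ltrDl.
  have [|y <- yq] := @qnorm_lift _ _ _ q (qnorm q + r); first by rewrite ltrDl.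
  rewrite cpi_mul (le_trans (qnorm_le _ _))// (le_trans (rnormM _ _))//.
  by rewrite ler_pM ?rnorm_ge0// ltW.
have p0 := qnorm_ge0 p; have q0 := qnorm_ge0 q.
apply/ler_addgt0Pr => e e0.
pose k := qnorm p + qnorm q + 1; have k0 : 0 < k by rewrite /k; lra.
pose r := Num.min 1 (e / k).
have r0 : 0 < r by rewrite lt_min ltr01 divr_gt0.
have r1 : r <= 1 by rewrite ge_min lexx.
have rk : r * k <= e by rewrite -ler_pdivlMr// ge_min lexx orbT.
have := le _ r0; move: rk; rewrite /k; nra.
Qed.

Lemma qnorm_star_mul q : qnorm (cquot_mul (cquot_star q) q) = qnorm q ^+ 2.
Proof.
have star_le p : qnorm (cquot_star p) <= qnorm p.
  apply: qnorm_ge => x <-.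
  by rewrite cpi_star (le_trans (qnorm_le _ _))// rnorm_star.
apply/le_anti/andP; split.
  by rewrite (le_trans (qnorm_mul _ _))// expr2 ler_wpM2r ?qnorm_ge0.
apply: qnorm_ge => y; elim/cquotP: q => x; rewrite cpi_star cpi_mul => /cpiP Ij.
pose j := y - cstar x ** x; apply/ler_addgt0Pr => r r0.
have [e [Ie es e1 je]] := ideal_unit (idealMl (cstar j) Ij) r0.
have e1l z : rnorm (z - e ** z) <= rnorm z.
  by rewrite -[leRHS]rnorm_star -rnorm_star cstarB cstarM es e1.
have xe : qnorm (cpi x) ^+ 2 <= rnorm (x - x ** e) ^+ 2.
  rewrite ler_sqr ?nnegrE ?qnorm_ge0 ?rnorm_ge0//.
  suff -> : cpi x = cpi (x - x ** e) by exact: qnorm_le.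
  by apply/cpiP; rewrite opprB addrC subrK; exact: idealMl.
rewrite (le_trans xe)// -rnorm_starM cstarB cstarM es.
have yjE : y - j = cstar x ** x by rewrite opprB addrC subrK.
have fr u v : (u - u ** e) - (v - v ** e) = (u - v) - (u - v) ** e.
  by rewrite opprD addrACA -opprD -cmulBl.
have fl u v : (u - e ** u) - (v - e ** v) = (u - v) - e ** (u - v).
  by rewrite opprD addrACA -opprD -cmulBr.
have -> : (cstar x - e ** cstar x) ** (x - x ** e) =
    ((y - y ** e) - e ** (y - y ** e)) - ((j - j ** e) - e ** (j - j ** e)).
  by rewrite fl fr yjE cmulBl -!cmulA -cmulBr.
rewrite (le_trans (rnormB _ _))// lerD//.
  by rewrite (le_trans (e1l _))// e1.
by rewrite (le_trans (e1l _)).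
Qed.

Lemma cquot_normM p q : `|cquot_mul p q| <= `|p| * `|q|.
Proof. by rewrite !cquot_normE -rmorphM lecR qnorm_mul. Qed.

Lemma cquot_norm_star q : `|cquot_mul (cquot_star q) q| = `|q| ^+ 2.
Proof. by rewrite !cquot_normE qnorm_star_mul rmorphXn. Qed.

HB.instance Definition _ := isCStarAlgebra.Build R Q
  cquot_mulA cquot_mulDl cquot_mulDr cquot_mulZl cquot_mulZr
  cquot_starK cquot_starD cquot_starZ cquot_starM
  cquot_normM cquot_norm_star.

End QuotientCStar.


(* Not required to be unital or continuous (continuity is automatic). *)
Record starHom (R : realType) (A B : cstarType R) := StarHom {
  starhom_fun :> A -> B;
  starhom_linear : linear starhom_fun;
  starhomM : forall x y, starhom_fun (x ** y) = starhom_fun x ** starhom_fun y;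
  starhom_star : forall x, starhom_fun (cstar x) = cstar (starhom_fun x)
}.

Section StarHom.
Variables (R : realType) (A B C : cstarType R).

Lemma starhomP (phi psi : starHom A B) : (forall a, phi a = psi a) -> phi = psi.
Proof.
case: phi psi => [f fl fM fs] [g gl gM gs] /= /funext fg; subst g.
by congr StarHom; exact: Prop_irrelevance.
Qed.

Program Definition starhom_comp (psi : starHom B C) (phi : starHom A B) :
  starHom A C := @StarHom R A C (psi \o phi) _ _ _.
Next Obligation. by move=> psi phi a x y; rewrite /= !starhom_linear. Qed.
Next Obligation. by move=> psi phi x y; rewrite /= !starhomM. Qed.
Next Obligation. by move=> psi phi x; rewrite /= !starhom_star. Qed.

Program Definition starhom0 : starHom A B := @StarHom R A B (fun=> 0) _ _ _.
Next Obligation. by move=> a x y; rewrite scaler0 addr0. Qed.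
Next Obligation. by move=> x y; rewrite cmul0r. Qed.
Next Obligation. by move=> x; rewrite cstar0. Qed.

End StarHom.

Program Definition quot_hom (R : realType) (B : cstarType R)
  (I : closedIdeal B) : starHom B (cquot I) :=
  @StarHom R B (cquot I) (cpi I) _ _ _.
Next Obligation. by move=> R B I a x y; rewrite cpiD cpiZ. Qed.
Next Obligation. by move=> R B I x y; rewrite -cpi_mul. Qed.
Next Obligation. by move=> R B I x; rewrite -cpi_star. Qed.

Section PointNorm.
Variables (R : realType) (A B : cstarType R).
Implicit Types phi psi : starHom A B.

HB.instance Definition _ := gen_eqMixin (starHom A B).
HB.instance Definition _ := gen_choiceMixin (starHom A B).
HB.instance Definition _ := isPointed.Build (starHom A B) (starhom0 A B).

Definition pointnorm_basic phi (F : seq A) (eps : R) : set (starHom A B) :=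
  [set psi | forall a, a \in F -> `|psi a - phi a| < eps%:C].

Definition pointnorm_nbhs phi : set_system (starHom A B) :=
  [set U | exists (F : seq A) (eps : R),
     0 < eps /\ pointnorm_basic phi F eps `<=` U].

HB.instance Definition _ := hasNbhs.Build (starHom A B) pointnorm_nbhs.

Lemma pointnorm_basicP phi F eps psi :
  pointnorm_basic phi F eps psi <-> forall a, a \in F -> rnorm (psi a - phi a) < eps.
Proof. by split=> h a /h; rewrite rnormE ltcR. Qed.

Lemma pointnorm_basic_refl phi F eps : 0 < eps -> pointnorm_basic phi F eps phi.
Proof. by move=> e0; apply/pointnorm_basicP => a _; rewrite subrr rnorm0. Qed.

Lemma pointnorm_filter phi : ProperFilter (nbhs phi).
Proof.
split.
  move=> [F [eps [e0 FU]]]. exact: FU (pointnorm_basic_refl phi e0).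
split=> [|U V [F [e [e0 FU]]] [G [d [d0 GV]]]|U V UV [F [e [e0 FU]]]].
- by exists [::], 1; split=> // ? _.
- exists (F ++ G), (Num.min e d); split; first by rewrite lt_min e0.
  move=> psi /pointnorm_basicP FG; split; [apply: FU|apply: GV];
    apply/pointnorm_basicP => a aF;
    have := FG a; rewrite mem_cat aF ?orbT lt_min => /(_ isT)/andP[] //.
- by exists F, e; split => // psi /FU /UV.
Qed.

Lemma pointnorm_singleton phi (U : set (starHom A B)) : nbhs phi U -> U phi.
Proof. by move=> [F [e [e0]]]; apply; exact: pointnorm_basic_refl. Qed.

Lemma seq_margin (f : A -> R) (F : seq A) (e : R) : (forall a, a \in F -> f a < e) ->
  exists2 d, 0 < d & forall a, a \in F -> f a + d <= e.
Proof.
elim: F => [|a F IH] fe; first by exists 1.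
have [|d d0 dF] := IH; first by move=> b bF; apply: fe; rewrite inE bF orbT.
exists (Num.min d (e - f a)); first by rewrite lt_min d0 subr_gt0 fe// inE eqxx.
move=> b; rewrite inE => /predU1P[->|bF].
  by rewrite -lerBrDl ge_min lexx orbT.
by rewrite (le_trans _ (dF _ bF))// lerD2l ge_min lexx.
Qed.

Lemma pointnorm_nbhs_nbhs phi (U : set (starHom A B)) :
  nbhs phi U -> nbhs phi (nbhs^~ U).
Proof.
move=> [F [e [e0 FU]]]; exists F, e; split => // psi /pointnorm_basicP Fpsi.
have [d d0 dF] := seq_margin Fpsi.
exists F, d; split => // chi /pointnorm_basicP Fchi; apply: FU.
apply/pointnorm_basicP => a aF; rewrite -(subrKA (psi a)).
rewrite (le_lt_trans (rnormD _ _))//.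
by have := dF _ aF; have := Fchi _ aF; lra.
Qed.

HB.instance Definition _ := Nbhs_isNbhsTopological.Build (starHom A B)
  pointnorm_filter pointnorm_singleton pointnorm_nbhs_nbhs.

End PointNorm.

Section Notions.
Variable R : realType.

Definition push_hom (A B : cstarType R) (I : closedIdeal B)
  (phi : starHom A B) : starHom A (cquot I) := starhom_comp (quot_hom I) phi.

Definition is_lift (A B : cstarType R) (I : closedIdeal B)
  (psi : starHom A (cquot I)) (phi : starHom A B) := psi = push_hom I phi.

Definition liftable (A B : cstarType R) (I : closedIdeal B) :
  set (starHom A (cquot I)) := [set psi | exists phi, is_lift psi phi].

Definition l_open (A : cstarType R) :=
  forall (B : cstarType R) (I : closedIdeal B), open (@liftable A B I).

Definition open_map (T U : topologicalType) (f : T -> U) :=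
  forall V : set T, open V -> open (f @` V).

(* Paths indexed by [0, 1] are represented by functions on R of which only the
   restriction to [0, 1] is constrained. *)
Definition path_on (T : topologicalType) (g : R -> T) :=
  {within `[0, 1], continuous g}.

Definition homotopy_lifting (A : cstarType R) :=
  forall (B : cstarType R) (I : closedIdeal B)
    (phi : R -> starHom A (cquot I)) (phi0 : starHom A B),
  path_on phi -> is_lift (phi 0) phi0 ->
  exists phibar : R -> starHom A B,
    [/\ path_on phibar, phibar 0 = phi0
      & forall t : R, 0 <= t <= 1 -> is_lift (phi t) (phibar t)].

Definition path_connected (T : topologicalType) (V : set T) :=
  forall x y, V x -> V y -> exists g : R -> T,
    [/\ path_on g, g 0 = x, g 1 = y & forall t : R, 0 <= t <= 1 -> V (g t)].

Definition locally_path_connected (T : topologicalType) :=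
  forall (x : T) (U : set T), nbhs x U ->
  exists V : set T, [/\ open V, V x, V `<=` U & path_connected V].

End Notions.

(* Main.v *)
(* Openness is applied to Hom(A, D/J), where D is a C*-algebra of
   bounded functions T -> B, continuous at prescribed points, and J consists of
   the f in D with f(x) in J_x for all x; a point of Hom(A, D/J) amounts to a
   family of homomorphisms A -> B/J_x, lifted through D simultaneously.

   Openness of Hom(A, B) -> Hom(A, B/I) at phi: take T = Hom(A, B/I), functions
   continuous at x0 = pi o phi, J_x0 = 0 and J_x = I elsewhere. The family that
   is the identity near x0 and constantly x0 elsewhere is close to the constant
   family, so it lifts by l-openness; the lift has value phi at x0, and by
   continuity its values near x0 are lifts close to phi.

   Liftable homomorphisms form a closed set: the tautological family of all
   liftable homomorphisms lifts, hence so does its perturbation equal to the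
   limit point phi near phi. Given a path (phi_t), the set of s such that
   (phi_(st))_t lifts to a path with the prescribed origin is then open and
   closed in R, hence contains 1.

   Local path-connectedness: take T = R, J_0 = J_1 = 0 and J_t = B elsewhere, so
   that a lift of (phi, psi) close to the constant phi is a short path from phi
   to psi. Conversely, if the liftable pi o phi has a path-connected
   neighbourhood, homotopy lifting makes all of this neighbourhood liftable. *)

From HB Require Import structures.
Require Import Defs.
From mathcomp Require Import all_boot all_order all_algebra.
From mathcomp Require Import complex.
From mathcomp Require Import boolp classical_sets functions reals topology.
From mathcomp Require Import normedtype lra.

Set Implicit Arguments.
Unset Strict Implicit.
Unset Printing Implicit Defensive.

Import Order.TTheory GRing.Theory Num.Theory.
Import numFieldNormedType.Exports.

Local Open Scope classical_set_scope.
Local Open Scope ring_scope.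
Local Open Scope complex_scope.

Lemma Re_norm_ge0 (R : realType) (k : R[i]) : 0 <= complex.Re `|k|.
Proof. by have := normr_ge0 k; rewrite normc_def lecR. Qed.

(** * Algebras of bounded functions *)

Section BCFun.
Variables (R : realType) (T : topologicalType) (B : cstarType R).

Definition cont_at (f : T -> B) (x : T) :=
  forall r : R, 0 < r -> nbhs x [set y | rnorm (f x - f y) < r].

(* [K = set0] gives l^oo(T, B) and [K = setT] gives C_b(T, B). *)
Definition bc_set (K : set T) : set (T -> B) :=
  [set f | (exists M : R, forall x, rnorm (f x) <= M) /\
           forall x, K x -> cont_at f x].

Variable K : set T.

Definition bc_pred : {pred T -> B} := fun f => `[< bc_set K f >].

Lemma bc_predP f : reflect (bc_set K f) (f \in bc_pred).
Proof. exact: asboolP. Qed.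

Lemma cont_atD f g x : cont_at f x -> cont_at g x -> cont_at (f + g) x.
Proof.
move=> fx gx r r0; have r2 : 0 < r / 2 by lra.
apply: filterS (filterI (fx _ r2) (gx _ r2)) => y /= [h1 h2].
rewrite opprD addrACA; have := rnormD (f x - f y) (g x - g y); lra.
Qed.

Lemma cont_atZ (k : R[i]) f x : cont_at f x -> cont_at (k *: f) x.
Proof.
move=> fx r r0; pose m := complex.Re `|k| + 1.
have k0 := Re_norm_ge0 k.
have m0 : 0 < m by rewrite /m; lra.
apply: filterS (fx (r / m) _); last exact: divr_gt0.
move=> y /=; rewrite ltr_pdivlMr// => h.
have := rnormZc k (f x - f y); rewrite scalerBr => ->.
have := rnorm_ge0 (f x - f y); rewrite /m in h; nra.
Qed.

Lemma cont_atM f g x : (exists M : R, forall x, rnorm (f x) <= M) ->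
  cont_at f x -> cont_at g x -> cont_at (fun y => f y ** g y) x.
Proof.
move=> [M fM] fx gx r r0.
have M0 : 0 <= M by apply: le_trans (rnorm_ge0 _) (fM x).
pose m := M + rnorm (g x) + 1; have g0 := rnorm_ge0 (g x).
have m0 : 0 < m by rewrite /m; lra.
have rm : 0 < r / m by exact: divr_gt0.
apply: filterS (filterI (fx _ rm) (gx _ rm)) => y /= [].
rewrite !ltr_pdivlMr// => h1 h2.
have -> : f x ** g x - f y ** g y = (f x - f y) ** g x + f y ** (g x - g y).
  by rewrite cmulBl cmulBr addrA subrK.
have := rnormD ((f x - f y) ** g x) (f y ** (g x - g y)).
have := rnormM (f x - f y) (g x); have := rnormM (f y) (g x - g y).
have := fM y; have := rnorm_ge0 (f y); rewrite /m in h1 h2.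
have := rnorm_ge0 (f x - f y); have := rnorm_ge0 (g x - g y).
move: h1 h2 M0 g0; move: (rnorm (f x - f y)) (rnorm (g x - g y)).
move: (rnorm (f y)) (rnorm (g x)).
move=> a b c d; nra.
Qed.

Lemma cont_at_star f x : cont_at f x -> cont_at (fun y => cstar (f y)) x.
Proof.
by move=> fx r /fx; apply: filterS => y /=; rewrite -cstarB rnorm_star.
Qed.

Lemma bc_submod : submod_closed bc_pred.
Proof.
split=> [|k f g /bc_predP[[M fM] fK] /bc_predP[[N gN] gK]]; apply/bc_predP; split.
- by exists 0 => x; rewrite rnorm0.
- move=> x _ r r0; apply: filterE => y /=; by rewrite subrr rnorm0.
- exists (complex.Re `|k| * M + N) => x.
  have k0 := Re_norm_ge0 k.
  rewrite (le_trans (rnormD _ _))// lerD// rnormZc ler_wpM2l//.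
- by move=> x Kx; apply: cont_atD (gK _ Kx); apply: cont_atZ; exact: fK.
Qed.

HB.instance Definition _ := GRing.isSubmodClosed.Build R[i] (T -> B) bc_pred
  bc_submod.

Record bcfun := BCFun { bc_fun :> T -> B; _ : bc_fun \in bc_pred }.

HB.instance Definition _ := [isSub for bc_fun].
HB.instance Definition _ := [Choice of bcfun by <:].
HB.instance Definition _ := [SubChoice_isSubLmodule of bcfun by <:].

Implicit Types f g : bcfun.

Lemma bcfunP f : bc_set K f.
Proof. by case: f => f /= /bc_predP. Qed.

Lemma bcfun_ext f g : f =1 g -> f = g.
Proof. by move=> fg; apply/val_inj/funext. Qed.

Definition bc_mk (f : T -> B) (fK : bc_set K f) : bcfun :=
  BCFun (introT (bc_predP f) fK).

(* If [T] is empty, this is [sup set0 = 0]. *)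
Definition bcnorm f : R := sup [set rnorm (f x) | x in setT].

Lemma bcnorm_ub f x : rnorm (f x) <= bcnorm f.
Proof.
apply: ub_le_sup; last by exists x.
by have [[M fM] _] := bcfunP f; exists M => _ [y _ <-].
Qed.

Lemma bcnorm_le f (r : R) : 0 <= r -> (forall x, rnorm (f x) <= r) -> bcnorm f <= r.
Proof.
move=> r0 fr; have [E0|E0] := pselect ([set rnorm (f x) | x in setT] !=set0).
  by apply: ge_sup => // _ [x _ <-].
by rewrite /bcnorm sup_out// => -[].
Qed.

Lemma bcnorm_ge0 f : 0 <= bcnorm f.
Proof.
have [[_ [x _ _]]|E0] := pselect ([set rnorm (f x) | x in setT] !=set0).
  exact: le_trans (rnorm_ge0 _) (bcnorm_ub f x).
by rewrite /bcnorm sup_out// => -[].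
Qed.

Definition bcnormC f : R[i] := (bcnorm f)%:C.

Lemma bcnormCD f g : bcnormC (f + g) <= bcnormC f + bcnormC g.
Proof.
rewrite /bcnormC -rmorphD lecR; apply: bcnorm_le => [|x].
  by rewrite addr_ge0 ?bcnorm_ge0.
by rewrite (le_trans (rnormD _ _))// lerD ?bcnorm_ub.
Qed.

Lemma bcnormCZ (k : R[i]) f : bcnormC (k *: f) = `|k| * bcnormC f.
Proof.
have nE (b : R[i]) : `|b| = (complex.Re `|b|)%:C by rewrite RRe_real// ger0_real.
have le (b : R[i]) (h : bcfun) : bcnorm (b *: h) <= complex.Re `|b| * bcnorm h.
  apply: bcnorm_le => [|x]; first by rewrite mulr_ge0 ?Re_norm_ge0 ?bcnorm_ge0.
  by rewrite rnormZc ler_wpM2l ?Re_norm_ge0// bcnorm_ub.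
rewrite /bcnormC nE -rmorphM; congr _%:C; apply/le_anti/andP; split=> //.
have [->|k0] := eqVneq k 0; first by rewrite normr0 mul0r bcnorm_ge0.
have := le k^-1 (k *: f); rewrite scalerA mulVf// scale1r normfV.
have a1 : 0 < complex.Re `|k| by rewrite -ltcR -nE normr_gt0.
have -> : complex.Re `|k|^-1 = (complex.Re `|k|)^-1.
  by apply: complexI; rewrite [in LHS]nE -fmorphV.
by rewrite mulrC ler_pdivlMr// mulrC.
Qed.

Lemma bcnormC_eq0 f : bcnormC f = 0 -> f = 0.
Proof.
move=> /complexI f0; apply: bcfun_ext => x; apply: rnorm0_eq0; apply/le_anti.
by rewrite rnorm_ge0 -f0 bcnorm_ub.
Qed.

HB.instance Definition _ := Lmodule_isNormed.Build R[i] bcfun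
  bcnormCD bcnormCZ bcnormC_eq0.


Lemma bcfun_complete (F : set_system bcfun) : ProperFilter F -> cauchy F -> cvg F.
Proof.
move=> FF /cauchyP Fc.
have q01 : 0 <= (1 / 2 : R) < 1 by lra.
have g0 n : 0 < (1 / 2 : R) ^+ n by rewrite exprn_gt0// divr_gt0.
have /choice[c cF] : forall n, exists c, F (ball (c : bcfun) ((1 / 2 : R) ^+ n)%:C).
  by move=> n; apply: Fc; rewrite -(rmorph0 (real_complex R)) ltcR.
have bE f g (r : R) : ball f r%:C g = (bcnorm (f - g) < r) :> Prop.
  by rewrite -ball_normE /ball_/= ltcR.
have cc x n : rnorm (c n.+1 x - c n x) <= 2 * (1 / 2) ^+ n.
  have [g []] := filter_ex (filterI (cF n) (cF n.+1)); rewrite !bE => h1 h2.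
  have := bcnorm_ub (c n - g) x; have := bcnorm_ub (c n.+1 - g) x.
  have := rnormB (c n.+1 x - g x) (c n x - g x); rewrite opprB addrA subrK.
  by have := g0 n; move: h2 => /=; rewrite exprS /=; lra.
have /choice[l lc] : forall x, exists l, forall n,
    rnorm (l - c n x) <= 2 * (1 / 2) ^+ n / (1 - 1 / 2).
  by move=> x; apply: geo_cvg.
have {}lc n x : rnorm (l x - c n x) <= 4 * (1 / 2) ^+ n.
  by have := lc x n; rewrite ler_pdivlMr; [have := g0 n; lra|lra].
have lK : bc_set K l.
  split=> [|x Kx r r0].
    exists (4 * (1 / 2) ^+ 0 + bcnorm (c 0%N)) => x.
    rewrite -(subrK (c 0%N x) (l x)) (le_trans (rnormD _ _))// lerD//.
    exact: bcnorm_ub.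
  have [N Nr] := geo_small 12 q01 r0.
  have r3 : 0 < r / 3 by lra.
  apply: filterS ((bcfunP (c N)).2 x Kx _ r3) => y /= cxy.
  have h1 := lc N x; have h2 := lc N y.
  have h3 := rnormD (l x - c N x) (c N x - c N y - (l y - c N y)).
  have h4 := rnormB (c N x - c N y) (l y - c N y).
  have E : l x - l y = l x - c N x + (c N x - c N y - (l y - c N y)).
    by rewrite addrA subrKA opprB addrA subrK.
  by rewrite -E in h3; lra.
apply/cvg_ex; exists (bc_mk lK); apply/cvg_ballP => _ /gt0_complexE[r r0 ->].
have [N Nr] := geo_small 5 q01 r0.
apply: filterS (cF N) => g; rewrite !bE => cg.
have g4 : 0 <= 4 * (1 / 2 : R) ^+ N by have := g0 N; lra.
have lcN : bcnorm (bc_mk lK - c N) <= 4 * (1 / 2) ^+ N.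
  by apply: bcnorm_le => // x; exact: lc.
have : bcnorm (bc_mk lK - g) <= bcnorm (bc_mk lK - c N) + bcnorm (c N - g).
  rewrite -lecR rmorphD/= (_ : _ - g = bc_mk lK - c N + (c N - g)).
    exact: bcnormCD.
  by rewrite addrA subrK.
by have := g0 N; lra.
Qed.

HB.instance Definition _ := Uniform_isComplete.Build bcfun bcfun_complete.

Lemma bc_mul_subproof f g : bc_set K (fun x => f x ** g x).
Proof.
have [[M fM] fK] := bcfunP f; have [[N gN] gK] := bcfunP g.
split=> [|x Kx]; last by apply: cont_atM; [exists M|exact: fK|exact: gK].
exists (M * N) => x; rewrite (le_trans (rnormM _ _))//.
by rewrite ler_pM ?rnorm_ge0.
Qed.

Lemma bc_star_subproof f : bc_set K (fun x => cstar (f x)).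
Proof.
have [[M fM] fK] := bcfunP f.
split=> [|x Kx]; last by apply: cont_at_star; exact: fK.
by exists M => x; rewrite rnorm_star.
Qed.

Definition bc_mul f g := bc_mk (bc_mul_subproof f g).
Definition bc_star f := bc_mk (bc_star_subproof f).

Lemma bc_mulA f g h : bc_mul f (bc_mul g h) = bc_mul (bc_mul f g) h.
Proof. by apply: bcfun_ext => x; exact: cmulA. Qed.

Lemma bc_mulDl f g h : bc_mul (f + g) h = bc_mul f h + bc_mul g h.
Proof. by apply: bcfun_ext => x; exact: cmulDl. Qed.

Lemma bc_mulDr f g h : bc_mul f (g + h) = bc_mul f g + bc_mul f h.
Proof. by apply: bcfun_ext => x; exact: cmulDr. Qed.

Lemma bc_mulZl (k : R[i]) f g : bc_mul (k *: f) g = k *: bc_mul f g.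
Proof. by apply: bcfun_ext => x; exact: cmulZl. Qed.

Lemma bc_mulZr (k : R[i]) f g : bc_mul f (k *: g) = k *: bc_mul f g.
Proof. by apply: bcfun_ext => x; exact: cmulZr. Qed.

Lemma bc_starK : involutive bc_star.
Proof. by move=> f; apply: bcfun_ext => x; exact: cstarK. Qed.

Lemma bc_starD f g : bc_star (f + g) = bc_star f + bc_star g.
Proof. by apply: bcfun_ext => x; exact: cstarD. Qed.

Lemma bc_starZ (k : R[i]) f : bc_star (k *: f) = Num.conj k *: bc_star f.
Proof. by apply: bcfun_ext => x; exact: cstarZ. Qed.

Lemma bc_starM f g : bc_star (bc_mul f g) = bc_mul (bc_star g) (bc_star f).
Proof. by apply: bcfun_ext => x; exact: cstarM. Qed.

Lemma bc_normM f g : `|bc_mul f g| <= `|f| * `|g|.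
Proof.
rewrite -[`|f| * `|g|](rmorphM (real_complex R)) lecR.
apply: bcnorm_le => [|x]; first by rewrite mulr_ge0 ?bcnorm_ge0.
by rewrite (le_trans (rnormM _ _))// ler_pM ?rnorm_ge0 ?bcnorm_ub.
Qed.

Lemma bc_norm_star f : `|bc_mul (bc_star f) f| = `|f| ^+ 2.
Proof.
apply/le_anti; rewrite -[`|f| ^+ 2](rmorphXn (real_complex R)) !lecR.
apply/andP; split.
  apply: bcnorm_le => [|x]; first by rewrite exprn_ge0 ?bcnorm_ge0.
  by rewrite rnorm_starM lerXn2r ?nnegrE ?rnorm_ge0 ?bcnorm_ge0 ?bcnorm_ub.
have s0 := bcnorm_ge0 (bc_mul (bc_star f) f).
rewrite -(sqr_sqrtr s0) lerXn2r ?nnegrE ?sqrtr_ge0 ?bcnorm_ge0//.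
apply: bcnorm_le => [|x]; first exact: sqrtr_ge0.
rewrite -(ler_pXn2r (ltn0Sn 1)) ?nnegrE ?sqrtr_ge0 ?rnorm_ge0// sqr_sqrtr//.
by rewrite -rnorm_starM; exact: (bcnorm_ub (bc_mul (bc_star f) f)).
Qed.

HB.instance Definition _ := isCStarAlgebra.Build R bcfun
  bc_mulA bc_mulDl bc_mulDr bc_mulZl bc_mulZr
  bc_starK bc_starD bc_starZ bc_starM bc_normM bc_norm_star.

End BCFun.

(** * Homomorphisms are contractive *)

Section StarHomNorm.
Variables (R : realType) (A B : cstarType R).
Implicit Types (phi : starHom A B) (a : A).

Lemma starhomZ phi k a : phi (k *: a) = k *: phi a.
Proof.
have z : phi 0 = 0.
  have := starhom_linear phi (-1) 0 0.
  by rewrite scaler0 addr0 scaleN1r addNr.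
by rewrite -[in LHS](addr0 (k *: a)) starhom_linear z addr0.
Qed.

Lemma starhomD phi a b : phi (a + b) = phi a + phi b.
Proof. by rewrite -[in LHS](scale1r a) starhom_linear scale1r. Qed.

Lemma half_scale (C : cstarType R) (x : C) : (2^-1)%:C *: x + (2^-1)%:C *: x = x.
Proof.
rewrite -scalerDl -rmorphD (_ : (2^-1 + 2^-1 : R) = 1) ?scale1r//; lra.
Qed.

(* [1 - z] is a square root of [1 - h^2] in the unitization. *)
Lemma sqrt_exists (C : cstarType R) (h : C) : cstar h = h -> rnorm h < 1 ->
  exists z, [/\ cstar z = z, z ** h = h ** z & z + z = h ** h + z ** z].
Proof.
move=> hs h1; pose w := h ** h; pose q := rnorm w.
have q0 : 0 <= q := rnorm_ge0 _.
have q1 : q < 1.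
  have := rnormM h h; rewrite -/w -/q; have := rnorm_ge0 h; nra.
pose F (z : C) := (2^-1)%:C *: (w + z ** z).
have FB x y : F x - F y = (2^-1)%:C *: (x ** (x - y) + (x - y) ** y).
  by rewrite -scalerBr opprD addrACA subrr add0r cmulBr cmulBl addrA subrK.
have h0 : (0 : R) <= 2^-1 by lra.
pose u n := iter n F 0.
have uq n : rnorm (u n) <= q.
  elim: n => [|n IH]; first by rewrite rnorm0.
  rewrite /u iterS -/(u n) /F rnormZ//.
  have := rnormD w (u n ** u n); have := rnormM (u n) (u n).
  have := rnorm_ge0 (u n); rewrite -/q; nra.
have us n : cstar (u n) = u n.
  elim: n => [|n IH]; first exact: cstar0.
  by rewrite /u iterS -/(u n) /F cstarZr cstarD !cstarM IH hs.
have uh n : u n ** h = h ** u n.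
  elim: n => [|n IH]; first by rewrite cmul0r cmulr0.
  rewrite /u iterS -/(u n) /F cmulZl cmulZr cmulDl cmulDr.
  have -> : u n ** u n ** h = h ** (u n ** u n) by rewrite -cmulA IH !cmulA IH.
  by rewrite -[w ** h]cmulA.
have uS n : rnorm (u n.+1 - u n) <= q * q ^+ n.
  elim: n => [|n IH].
    rewrite subr0 expr0 mulr1; exact: uq.
  have -> : u n.+2 - u n.+1 =
      (2^-1)%:C *: (u n.+1 ** (u n.+1 - u n) + (u n.+1 - u n) ** u n) := FB _ _.
  rewrite rnormZ// exprS.
  have := rnormD (u n.+1 ** (u n.+1 - u n)) ((u n.+1 - u n) ** u n).
  have := rnormM (u n.+1) (u n.+1 - u n); have := rnormM (u n.+1 - u n) (u n).
  have := uq n; have := uq n.+1; have := rnorm_ge0 (u n.+1 - u n).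
  move: (q ^+ n) IH => g; nra.
have q01 : 0 <= q < 1 by rewrite q0 q1.
have [z zu] := geo_cvg q0 q01 uS.
have zlim (r : R) : 0 < r -> exists n, rnorm (z - u n) <= r /\ rnorm (z - u n.+1) <= r.
  move=> r0; have [N Nr] := geo_small (q / (1 - q)) q01 r0.
  have g0 : 0 <= q / (1 - q) * q ^+ N.
    by rewrite !mulr_ge0 ?exprn_ge0 ?invr_ge0 ?subr_ge0// ltW.
  exists N; split; first by rewrite (le_trans (zu N))// mulrAC ltW.
  rewrite (le_trans (zu N.+1))// mulrAC exprS mulrCA (le_trans _ (ltW Nr))//.
  by rewrite ler_piMl// ltW.
have lim0 (x : C) (M : R) : 0 < M ->
    (forall r, 0 < r -> r <= 1 -> rnorm x <= M * r) -> x = 0.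
  move=> M0 xr; apply/rnorm0_eq0/le_anti; rewrite rnorm_ge0 andbT.
  apply/ler_addgt0Pr => r r0; rewrite add0r.
  have m0 : 0 < Num.min 1 (r / M) by rewrite lt_min ltr01 divr_gt0.
  rewrite (le_trans (xr _ m0 _))//; first by rewrite ge_min lexx.
  by rewrite mulrC -ler_pdivlMr// ge_min lexx orbT.
have zs : cstar z = z.
  apply/subr0_eq; apply: (lim0 _ 2) => // r r0 _; have [n [zn _]] := zlim _ r0.
  have -> : cstar z - z = cstar (z - u n) - (z - u n).
    by rewrite cstarB us opprB addrA subrK.
  have := rnormB (cstar (z - u n)) (z - u n); rewrite rnorm_star; lra.
have hb := rnorm_ge0 h.
have zh : z ** h = h ** z.
  apply/subr0_eq; apply: (lim0 _ 2) => // r r0 _; have [n [zn _]] := zlim _ r0.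
  have -> : z ** h - h ** z = (z - u n) ** h - h ** (z - u n).
    by rewrite cmulBl cmulBr uh opprB addrA subrK.
  have := rnormB ((z - u n) ** h) (h ** (z - u n)).
  have := rnormM (z - u n) h; have := rnormM h (z - u n).
  have := rnorm_ge0 (z - u n); nra.
have zb := rnorm_ge0 z.
exists z; split=> //; apply/subr0_eq.
apply: (lim0 _ (rnorm z + 3)) => [|r r0 r1]; first lra.
have [n [zn zn1]] := zlim _ r0.
have uE : u n.+1 + u n.+1 = w + u n ** u n by exact: half_scale.
have -> : z + z - (h ** h + z ** z) =
    (z - u n.+1) + (z - u n.+1) - (z ** (z - u n) + (z - u n) ** u n).
  have -> : z ** (z - u n) + (z - u n) ** u n = z ** z - u n ** u n.
    by rewrite cmulBr cmulBl addrA subrK.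
  by rewrite [z - _ + _]addrACA -opprD uE opprB !opprD !addrA subrK.
have := rnormB ((z - u n.+1) + (z - u n.+1)) (z ** (z - u n) + (z - u n) ** u n).
have := rnormD (z - u n.+1) (z - u n.+1).
have := rnormD (z ** (z - u n)) ((z - u n) ** u n).
have := rnormM z (z - u n); have := rnormM (z - u n) (u n); have := uq n.
have := rnorm_ge0 (z - u n); have := rnorm_ge0 (u n).
move: (rnorm (z - u n)) zn (rnorm (u n)) => a ar b; nra.
Qed.

(* [1 - z + i h] is unitary in the unitization. *)
Lemma sqrt_norm (C : cstarType R) (h z : C) : cstar h = h -> cstar z = z ->
  z ** h = h ** z -> z + z = h ** h + z ** z -> rnorm h <= 1.
Proof.
move=> hs zs zh zE.
have key (k : R[i]) : Num.conj k = - k -> k * k = -1 ->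
    rnorm (h - h ** z + k *: (h ** h)) = rnorm h.
  move=> ks kk; apply/eqP.
  rewrite -(eqrXn2 (ltn0Sn 1)) ?rnorm_ge0// -!rnorm_Mstar; apply/eqP; congr rnorm.
  have [s sE] : exists s, s = h - h ** z by exists (h - h ** z).
  have ss : cstar s = s by rewrite sE cstarB cstarM hs zs zh.
  have sh : s ** h = h ** s by rewrite sE cmulBl cmulBr -cmulA zh.
  have shh : s ** (h ** h) = h ** h ** s by rewrite cmulA sh -cmulA sh cmulA.
  rewrite -sE cstarD ss cstarZ cstarM hs ks.
  rewrite cmulDl !cmulDr !cmulZl !cmulZr scalerA.
  rewrite mulrN kk opprK scale1r shh scaleNr addrA addrNK.
  have -> : s ** s = (h - h ** z) ** (h - z ** h) by rewrite zh -sE.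
  rewrite cmulBr !cmulBl.
  have -> : h ** z ** (z ** h) = h ** (z + z) ** h - h ** h ** (h ** h).
    by rewrite zE cmulDr cmulDl !cmulA addrAC subrr add0r.
  rewrite cmulDr cmulDl !cmulA.
  move: (h ** z ** h) (h ** h) => b a.
  rewrite -[b + b - _]addrA [- (b + (b - _))]opprD [b + (- b - _)]addrA.
  by rewrite subrr add0r opprK addrA !subrK.
have ki := @conjCi R[i]; have ii := @sqrCi R[i]; rewrite expr2 in ii.
have k1 := key _ ki ii.
have k2 : rnorm (h - h ** z + - 'i%R *: (h ** h)) = rnorm h.
  by apply: key; [rewrite rmorphN/= ki|rewrite mulrNN].
have hh : rnorm h ^+ 2 <= rnorm h.
  rewrite -rnorm_starM hs -(rnormZi (h ** h)).
  have := rnorm_half (erefl ('i%R *: (h ** h) + 'i%R *: (h ** h))).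
  have := rnormB (h - h ** z + 'i%R *: (h ** h)) (h - h ** z + - 'i%R *: (h ** h)).
  rewrite k1 k2 scaleNr opprB addrC subrKA; lra.
have := rnorm_ge0 h; rewrite expr2 in hh; nra.
Qed.

Lemma starhom_norm phi a : rnorm (phi a) <= rnorm a.
Proof.
have sa (h : A) : cstar h = h -> rnorm (phi h) <= rnorm h.
  move=> hs; apply/ler_addgt0Pr => r r0.
  have h0 := rnorm_ge0 h; have hr : 0 < rnorm h + r by lra.
  pose k := (rnorm h + r)^-1; have k0 : 0 < k by rewrite invr_gt0.
  have hs' : cstar (k%:C *: h) = k%:C *: h by rewrite cstarZr hs.
  have [|z [zs zh zE]] := sqrt_exists hs'.
    by rewrite rnormZ ?(ltW k0)// mulrC ltr_pdivrMr// mul1r ltrDl.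
  have : rnorm (phi (k%:C *: h)) <= 1.
    apply: (@sqrt_norm _ _ (phi z)).
    - by rewrite -starhom_star hs'.
    - by rewrite -starhom_star zs.
    - by rewrite -!starhomM zh.
    - by rewrite -starhomD zE starhomD !starhomM.
  by rewrite starhomZ rnormZ ?(ltW k0)// mulrC ler_pdivrMr// mul1r.
rewrite -(ler_pXn2r (ltn0Sn 1)) ?nnegrE ?rnorm_ge0// -!rnorm_starM.
by rewrite -starhom_star -starhomM sa// cstarM cstarK.
Qed.

End StarHomNorm.

Lemma cquot_rnormE (R : realType) (B : cstarType R) (I : closedIdeal B)
  (q : cquot I) : rnorm q = qnorm q.
Proof. by []. Qed.

Lemma bc_rnormE (R : realType) (T : topologicalType) (B : cstarType R)
  (K : set T) (f : bcfun B K) : rnorm f = bcnorm f.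
Proof. by []. Qed.

(** * Ideals of function algebras and glued homomorphisms *)

Section Ideals.
Variables (R : realType) (B : cstarType R).

Lemma closed_rnorm (S : set B) : (forall x, (forall r : R, 0 < r ->
  exists2 y, S y & rnorm (x - y) < r) -> S x) -> closed S.
Proof.
move=> SP x xS; apply: SP => r r0.
have [|y [Sy xy]] := xS [set y | rnorm (x - y) < r]; last by exists y.
by apply/nbhs_rnormP; exists r.
Qed.

Lemma zero_ideal_closed : closed [set 0 : B].
Proof.
apply: closed_rnorm => x xr; apply/rnorm0_eq0/le_anti; rewrite rnorm_ge0 andbT.
apply/ler_addgt0Pr => r /xr[_ ->]; rewrite subr0 add0r; exact: ltW.
Qed.

Program Definition zero_ideal : closedIdeal B :=
  @ClosedIdeal R B [set 0] erefl _ _ _ _ zero_ideal_closed.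
Next Obligation. by move=> x y /= -> ->; rewrite addr0. Qed.
Next Obligation. by move=> a x /= ->; rewrite scaler0. Qed.
Next Obligation. by move=> x y /= ->; rewrite cmulr0. Qed.
Next Obligation. by move=> x y /= ->; rewrite cmul0r. Qed.

Definition full_ideal : closedIdeal B :=
  @ClosedIdeal R B setT I (fun _ _ _ _ => I) (fun _ _ _ => I)
    (fun _ _ _ => I) (fun _ _ _ => I) (@closedT _).

Variables (T : topologicalType) (K : set T) (J : T -> closedIdeal B).

Lemma fam_ideal_closed :
  closed [set f : bcfun B K | forall x, ideal_set (J x) (f x)].
Proof.
move=> f fS x; apply: ideal_approx => r r0.
have [|g [gS fg]] := fS [set g | bcnorm (f - g) < r].
  rewrite -nbhs_ballE; exists r%:C => /=.
    by rewrite -(rmorph0 (real_complex R)) ltcR.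
  by move=> g; rewrite -ball_normE /ball_/= ltcR.
exists (g x); first exact: gS.
by apply: le_lt_trans fg; exact: (bcnorm_ub (f - g)).
Qed.

Program Definition fam_ideal : closedIdeal (bcfun B K) :=
  @ClosedIdeal R (bcfun B K) _ _ _ _ _ _ fam_ideal_closed.
Next Obligation. by move=> x; exact: ideal0. Qed.
Next Obligation. by move=> f g fJ gJ x; exact: idealD. Qed.
Next Obligation. by move=> k f fJ x; exact: idealZ. Qed.
Next Obligation. by move=> f g fJ x; exact: (idealMl _ (fJ x)). Qed.
Next Obligation. by move=> f g fJ x; exact: (Defs.idealMr _ (fJ x)). Qed.

Program Definition bc_eval (x : T) : starHom (bcfun B K) B :=
  @StarHom R (bcfun B K) B (fun f => f x) _ _ _.
Next Obligation. by []. Qed.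
Next Obligation. by []. Qed.
Next Obligation. by []. Qed.

Variable A : cstarType R.

Program Definition bc_hom (h : T -> starHom A B)
    (hK : forall a, bc_set K (fun x => h x a)) : starHom A (bcfun B K) :=
  @StarHom R A (bcfun B K) (fun a => bc_mk (hK a)) _ _ _.
Next Obligation.
by move=> h hK k a b; apply: bcfun_ext => x; exact: starhom_linear.
Qed.
Next Obligation.
by move=> h hK a b; apply: bcfun_ext => x; exact: starhomM.
Qed.
Next Obligation.
by move=> h hK a; apply: bcfun_ext => x; exact: starhom_star.
Qed.

Lemma bc_set_cst (b : B) : bc_set K (fun=> b).
Proof.
split=> [|x _ r r0]; first by exists (rnorm b).
by apply: filterE => y /=; rewrite subrr rnorm0.
Qed.

Definition bc_cst (phi : starHom A B) : starHom A (bcfun B K) :=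
  @bc_hom (fun=> phi) (fun a => bc_set_cst (phi a)).

Lemma glue_hom (s : A -> bcfun B K) :
  (forall x, exists psi : starHom A (cquot (J x)),
     forall a, cpi (J x) (s a x) = psi a) ->
  exists Psi : starHom A (cquot fam_ideal),
     forall a, Psi a = cpi fam_ideal (s a).
Proof.
move=> sP.
have lin : linear (fun a => cpi fam_ideal (s a)).
  move=> k a b; rewrite -cpiZ -cpiD; apply/cpiP => x; apply/cpiP.
  have [psi psiE] := sP x.
  by rewrite [RHS]cpiD cpiZ !psiE starhom_linear.
have mul a b : cpi fam_ideal (s (a ** b)) = cpi fam_ideal (s a) ** cpi fam_ideal (s b).
  rewrite [RHS]cpi_mul; apply/cpiP => x; apply/cpiP.
  have [psi psiE] := sP x.
  by rewrite -[RHS]cpi_mul !psiE starhomM.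
have star a : cpi fam_ideal (s (cstar a)) = cstar (cpi fam_ideal (s a)).
  rewrite [RHS]cpi_star; apply/cpiP => x; apply/cpiP.
  have [psi psiE] := sP x.
  by rewrite -[RHS]cpi_star !psiE starhom_star.
by exists (StarHom lin mul star).
Qed.

(* [s a] represents the value at [a] of the perturbed family, and [g] a small
   representative of its difference with [Phi0 a]. *)
Lemma glue_near (Phi0 : starHom A (bcfun B K))
    (N : set (starHom A (cquot fam_ideal))) : nbhs (push_hom fam_ideal Phi0) N ->
  exists (F : seq A) (eps : R), 0 < eps /\
  forall s : A -> bcfun B K,
    (forall x, exists psi : starHom A (cquot (J x)),
      forall a, cpi (J x) (s a x) = psi a) ->
    (forall a, a \in F -> exists2 g : bcfun B K, bcnorm g < eps &
      forall x, ideal_set (J x) (s a x - Phi0 a x - g x)) ->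
  exists2 Psi, N Psi & forall a, Psi a = cpi fam_ideal (s a).
Proof.
move=> [F [eps [e0 FN]]]; exists F, eps; split=> // s sP sF.
have [Psi PsiE] := glue_hom sP; exists Psi => //; apply: FN.
apply/pointnorm_basicP => a /sF[g ge gJ].
rewrite PsiE [push_hom _ _ a]/= -cpiB.
have -> : cpi fam_ideal (s a - Phi0 a) = cpi fam_ideal g by apply/cpiP.
by rewrite cquot_rnormE; apply: le_lt_trans (qnorm_le _ _) _; rewrite bc_rnormE.
Qed.

End Ideals.

Lemma bounded_section (R : realType) (B : cstarType R) (I : closedIdeal B) :
  exists sec : cquot I -> B, forall q,
    cpi I (sec q) = q /\ rnorm (sec q) <= 2 * rnorm q.
Proof.
suff /choice[sec secP] : forall q : cquot I, exists x,
    cpi I x = q /\ rnorm x <= 2 * rnorm q.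
  by exists sec.
move=> q; have [q0|/eqP q0] := pselect (rnorm q = 0).
  by exists 0; rewrite q0 rnorm0 mulr0 (rnorm0_eq0 q0) cpi0.
have qp : 0 < rnorm q by rewrite lt_neqAle eq_sym q0 rnorm_ge0.
have [|x xq xr] := @qnorm_lift _ _ I q (2 * rnorm q).
  by rewrite -cquot_rnormE; lra.
by exists x; rewrite xq ltW.
Qed.

Lemma open_nbhsP (T : topologicalType) (U : set T) :
  open U <-> forall x, U x -> nbhs x U.
Proof. by rewrite openE; split=> h; exact: h. Qed.

Section StarHomTopology.
Variables (R : realType) (A B : cstarType R).

Lemma pointnorm_basic_nbhs (phi : starHom A B) (F : seq A) (eps : R) :
  0 < eps -> nbhs phi (pointnorm_basic phi F eps).
Proof. by move=> e0; exists F, eps; split. Qed.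

Lemma near_seq (T : topologicalType) (x : T) (F : seq A) (P : A -> set T) :
  (forall a, a \in F -> nbhs x (P a)) ->
  nbhs x [set y | forall a, a \in F -> P a y].
Proof.
elim: F => [|a F IH] FP; first by apply: filterE => y b.
have h1 := FP a (mem_head _ _).
have /IH h2 : forall b, b \in F -> nbhs x (P b).
  by move=> b bF; apply: FP; rewrite inE bF orbT.
apply: filterS (filterI h1 h2) => y /= [Pa Pb] b.
by rewrite inE => /predU1P[->|/Pb].
Qed.

Lemma starHom_cvg (T : topologicalType) (x : T) (h : T -> starHom A B) U :
  (forall a, cont_at (fun y => h y a) x) -> nbhs (h x) U ->
  nbhs x [set y | U (h y)].
Proof.
move=> hx [F [e [e0 FU]]].
have : nbhs x [set y | forall a, a \in F -> rnorm (h x a - h y a) < e].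
  by apply: near_seq => a _; exact: hx.
apply: filterS => y yF; apply: FU; apply/pointnorm_basicP => a /yF.
by rewrite rnormC.
Qed.

Lemma starHom_continuous (T : topologicalType) (h : T -> starHom A B) :
  (forall a x, cont_at (fun y => h y a) x) -> continuous h.
Proof. by move=> hc x U hU; apply: (starHom_cvg (fun a => hc a x) hU). Qed.

End StarHomTopology.

(** * Lifting continuous paths from a quotient *)

Section UnitInterval.
Variable R : realType.
Implicit Types s t : R.

Definition clamp t : R := Num.max 0 (Num.min 1 t).

Lemma clamp_itv t : 0 <= clamp t <= 1.
Proof.
rewrite le_max lexx/= ge_max ler01/=.
by rewrite ge_min lexx.
Qed.

Lemma clamp_id t : 0 <= t <= 1 -> clamp t = t.
Proof. by move=> /andP[t0 t1]; rewrite /clamp (min_idPr t1) (max_idPr t0). Qed.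

Lemma clamp_le0 t : t <= 0 -> clamp t = 0.
Proof.
move=> t0; rewrite /clamp; apply/max_idPl.
by rewrite ge_min t0 orbT.
Qed.

Lemma clamp_ge1 t : 1 <= t -> clamp t = 1.
Proof. by move=> t1; rewrite /clamp (min_idPl t1) (max_idPr ler01). Qed.

Lemma clamp_lip s t : `|clamp s - clamp t| <= `|s - t|.
Proof.
have clampP x : [\/ x <= 0 /\ clamp x = 0, 1 <= x /\ clamp x = 1 |
    0 <= x <= 1 /\ clamp x = x].
  have [x0|x0] := leP x 0; first by apply: Or31; rewrite clamp_le0.
  have [x1|x1] := leP 1 x; first by apply: Or32; rewrite clamp_ge1.
  by apply: Or33; rewrite clamp_id !ltW.
have h1 := ler_norm (s - t); have h2 := ler_norm (t - s).
rewrite distrC in h2; rewrite ler_norml.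
have [[? ->]|[? ->]|[? ->]] := clampP s;
  have [[? ->]|[? ->]|[? ->]] := clampP t; apply/andP; split; lra.
Qed.

Lemma nbhs_distP t (U : set R) :
  nbhs t U <-> exists2 d : R, 0 < d & forall s, `|t - s| < d -> U s.
Proof.
rewrite -nbhs_ballE; split=> [[d d0 dU]|[d d0 dU]].
  by exists d => // s ts; exact: dU.
by exists d => //= s; exact: dU.
Qed.

Lemma path_on_clamp (T : topologicalType) (g : R -> T) : path_on g ->
  forall t U, nbhs (g (clamp t)) U -> nbhs t [set s | U (g (clamp s))].
Proof.
move=> /subspace_continuousP gc t U gU; have ct := clamp_itv t.
have /nbhs_distP[d d0 dU] := gc (clamp t) ct _ gU.
apply/nbhs_distP; exists d => // s st /=; apply: dU; last exact: clamp_itv.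
exact: le_lt_trans (clamp_lip _ _) st.
Qed.

Lemma clopen_real (U : set R) : U 0 ->
  (forall t, U t -> nbhs t U) ->
  (forall t, (forall V, nbhs t V -> U `&` V !=set0) -> U t) -> U 1.
Proof.
move=> U0 Uo Uc.
have cR : connected [set: R] by apply/connected_intervalP => x y _ _ z _.
suff -> : U = setT by [].
apply: cR; first by exists 0.
  by exists U; [exact/open_nbhsP|rewrite setTI].
by exists U; [exact: Uc|rewrite setTI].
Qed.

Variable B : cstarType R.

Lemma lip_cont (f : R -> B) (M : R) t :
  (forall s, rnorm (f t - f s) <= M * `|t - s|) -> cont_at f t.
Proof.
move=> fM r r0; apply/nbhs_distP; pose m := `|M| + 1.
have m0 : 0 < m by rewrite ltr_wpDl.
exists (r / m); first exact: divr_gt0.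
move=> s; rewrite ltr_pdivlMr// => sr /=; apply: le_lt_trans (fM s) _.
have := ler_norm M; have := normr_ge0 (t - s); rewrite /m in sr; nra.
Qed.

Lemma unif_cont (q : R -> B) (r : R) : 0 < r -> (forall t, cont_at q t) ->
  exists2 d : R, 0 < d & forall s t, 0 <= s <= 1 -> `|s - t| < d ->
    rnorm (q s - q t) < r.
Proof.
move=> r0 qc; have r2 : 0 < r / 2 by lra.
pose P d s := forall t, `|s - t| < d -> rnorm (q s - q t) < r.
have Pnear s : `[0, 1]%classic s -> \forall s' \near s & d \near (0 : R), P d s'.
  move=> _; have /nbhs_distP[e e0 eq] := qc s _ r2.
  exists ([set u | `|s - u| < e / 2], [set d | `|0 - d| < e / 2]) => /=.
    by split; apply/nbhs_distP; exists (e / 2) => //; lra.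
  move=> [u d] /= [su]; rewrite sub0r normrN => de t ut.
  have h1 : rnorm (q s - q u) < r / 2 by apply: eq; lra.
  have h2 : rnorm (q s - q t) < r / 2.
    apply: eq; have := ler_distD u s t; have := ler_norm d; lra.
  have -> : q u - q t = (q s - q t) - (q s - q u) by rewrite opprB [RHS]addrC subrKA.
  have := rnormB (q s - q t) (q s - q u); lra.
have /compact_near_coveringP cov := @segment_compact R 0 1.
have /nbhs_distP[e e0 eP] : nbhs (0 : R) [set d | `[0, 1] `<=` P d].
  exact: cov Pnear.
exists (e / 2) => [|s t s01 st]; first by rewrite divr_gt0.
by apply: (eP (e / 2)) => //=; rewrite sub0r normrN ger0_norm; lra.
Qed.

Lemma rnorm_conv (c : R) (u v : B) (m : R) : 0 <= c <= 1 ->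
  rnorm u <= m -> rnorm v <= m -> rnorm ((1 - c)%:C *: u + c%:C *: v) <= m.
Proof.
move=> /andP[c0 c1] um vm; rewrite (le_trans (rnormD _ _))//.
rewrite !rnormZ ?subr_ge0//; nra.
Qed.

End UnitInterval.

Section PathLifting.
Variables (R : realType) (B : cstarType R) (I : closedIdeal B).

(* The lift is the piecewise linear interpolation of lifts at multiples of [1/N]. *)
Lemma approx_lift (q : R -> cquot I) (r e : R) : 0 < e ->
  (forall t, cont_at q t) -> (forall t, 0 <= t <= 1 -> rnorm (q t) < r) ->
  exists f : bcfun B [set: R], bcnorm f <= r /\
    forall t, 0 <= t <= 1 -> rnorm (q t - cpi I (f t)) <= e.
Proof.
move=> e0 qc qr; have [d d0 dP] := unif_cont e0 qc.
have [N dN] : exists N : nat, 1 / d < N.+1%:R.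
  exists (Num.bound (1 / d)); rewrite (lt_trans (archi_boundP _))//.
    by rewrite divr_ge0 ?ltW.
  by rewrite ltr_nat.
pose M : R := N.+1%:R; have M0 : 0 < M by rewrite ltr0n.
have Md : 1 < d * M by rewrite mulrC -ltr_pdivrMr.
have /choice[b bP] : forall n : nat, exists x : B,
    (n <= N.+1)%N -> cpi I x = q (n%:R / M) /\ rnorm x < r.
  move=> n; have [nN|] := leqP n N.+1; last by exists 0.
  have [|x xq xr] := @qnorm_lift _ _ I (q (n%:R / M)) r; last by exists x.
  by rewrite -cquot_rnormE; apply: qr; rewrite divr_ge0// ler_pdivrMr// mul1r ler_nat.
pose c n (t : R) := clamp (t * M - n%:R).
pose f n t := b 0%N + \sum_(i < n) (c i t)%:C *: (b i.+1 - b i).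
have fS n t : f n.+1 t = f n t + (c n t)%:C *: (b n.+1 - b n).
  by rewrite /f big_ord_recr addrA.
have fc n t : cont_at (f n) t.
  elim: n => [|n IH].
    by move=> s s0; apply: filterE => u /=; rewrite /f !big_ord0 subrr rnorm0.
  rewrite (_ : f n.+1 = f n + (fun t => (c n t)%:C *: (b n.+1 - b n))); last first.
    by apply/funext => u; exact: fS.
  apply: cont_atD => //; apply: (@lip_cont _ _ _ (rnorm (b n.+1 - b n) * M)) => s.
  rewrite -scalerBl -rmorphB rnormZc mulrC -mulrA ler_wpM2l ?rnorm_ge0//.
  rewrite normc_def/= expr0n addr0 sqrtr_sqr (le_trans (clamp_lip _ _))//.
  rewrite opprB addrA subrK -mulrBl normrM mulrC gtr0_norm//.
have fP n : (n <= N.+1)%N -> [/\ forall t, rnorm (f n t) <= r,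
    forall t, n%:R <= t * M -> f n t = b n &
    forall t, 0 <= t -> t * M <= n%:R -> rnorm (q t - cpi I (f n t)) <= e].
  elim: n => [|n IH] nN.
    have f0 t : f 0%N t = b 0%N by rewrite /f big_ord0 addr0.
    have [b0 b0r] := bP 0%N isT.
    split=> [t|//|t t0 tM]; rewrite f0; first exact: ltW.
    have -> : t = 0 by apply/le_anti; rewrite t0 andbT -(pmulr_lle0 _ M0).
    by rewrite b0 mul0r subrr rnorm0 ltW.
  have [fr fb fq] := IH (ltnW nN).
  have [bn bnr] := bP _ (ltnW nN); have [bn1 bn1r] := bP _ nN.
  have lo t : t * M <= n%:R -> f n.+1 t = f n t.
    by move=> tM; rewrite fS /c clamp_le0 ?subr_le0// scale0r addr0.
  have hi t : n%:R <= t * M ->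
      f n.+1 t = (1 - c n t)%:C *: b n + (c n t)%:C *: b n.+1.
    move=> tM; rewrite fS fb// rmorphB scalerBl scale1r scalerBr.
    by rewrite addrA addrAC.
  split=> t.
  - have [/lo->//|/ltW/hi->] := leP (t * M) n%:R.
    by apply: rnorm_conv; [exact: clamp_itv|exact: ltW|exact: ltW].
  - move=> tM; rewrite hi; last by apply: le_trans tM; rewrite ler_nat.
    rewrite /c clamp_ge1 ?subrr ?scale0r ?add0r ?scale1r//.
    by rewrite lerBrDl -natr1 in tM *.
  - move=> t0 tM; have [tn|/ltW tn] := leP (t * M) n%:R.
      by rewrite lo//; exact: fq.
    rewrite hi// cpiD !cpiZ bn bn1.
    have -> : q t = (1 - c n t)%:C *: q t + (c n t)%:C *: q t.
      by rewrite -scalerDl -rmorphD subrK scale1r.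
    rewrite opprD addrACA -!scalerBr.
    have tN : t <= 1.
      by rewrite -(ler_pM2r M0) mul1r (le_trans tM)// ler_nat.
    have E (k : nat) : `|t * M - k%:R| <= 1 -> rnorm (q t - q (k%:R / M)) <= e.
      move=> tk; apply/ltW/dP; first by rewrite t0.
      rewrite -(ltr_pM2r M0) -{2}(gtr0_norm M0) -normrM mulrBl divfK ?gt_eqF//.
      exact: le_lt_trans Md.
    apply: rnorm_conv; first exact: clamp_itv.
      by apply: E; rewrite ler_norml -natr1 in tM *; lra.
    by apply: E; rewrite ler_norml -natr1 in tM *; lra.
have [fr _ fq] := fP N.+1 (leqnn _).
have fK : bc_set [set: R] (f N.+1) by split=> [|t _]; [exists r|exact: fc].
exists (bc_mk fK); split=> [|t /andP[t0 t1]].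
  apply: bcnorm_le => //; exact: le_trans (rnorm_ge0 _) (fr 0).
by apply: fq => //; rewrite ler_piMl// ltW.
Qed.

Lemma path_lift (q : R -> cquot I) (r : R) : 0 < r ->
  (forall t, cont_at q t) -> (forall t, 0 <= t <= 1 -> rnorm (q t) < r) ->
  exists f : bcfun B [set: R], bcnorm f <= 2 * r /\
    forall t, 0 <= t <= 1 -> cpi I (f t) = q t.
Proof.
move=> r0 qc qr; pose g n : R := (1 / 2) ^+ n.
have q01 : 0 <= (1 / 2 : R) < 1 by lra.
have g0 n : 0 < g n by rewrite exprn_gt0// divr_gt0.
pose D : cstarType R := bcfun B [set: R].
pose Inv n (u : D) := forall t, 0 <= t <= 1 -> rnorm (q t - cpi I (u t)) < r * g n.
have /choice[v vP] : forall p : nat * D, exists v, Inv p.1 p.2 ->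
    Inv p.1.+1 v /\ bcnorm (v - p.2) <= r * g p.1.
  move=> [n u]/=; have [uI|] := pselect (Inv n u); last by exists 0.
  have e0 : 0 < r * g n.+1 / 2 by rewrite divr_gt0// mulr_gt0.
  have [|f [fr fq]] := approx_lift e0 _ uI.
    move=> t s s0; have s2 : 0 < s / 2 by lra.
    have uc := (bcfunP u).2 t Logic.I.
    apply: filterS (filterI (qc t _ s2) (uc _ s2)) => x /= [h1 h2].
    have -> : q t - cpi I (u t) - (q x - cpi I (u x)) =
        q t - q x - cpi I (u t - u x).
      rewrite cpiB !opprB -!addrA; congr (_ + _).
      by rewrite addrC -addrA addrCA.
    have := rnormB (q t - q x) (cpi I (u t - u x)).
    have := qnorm_le I (u t - u x); rewrite -cquot_rnormE; lra.
  exists (u + f) => _; split; last by rewrite addrC addKr.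
  move=> t /fq; rewrite [(u + f) t]/= cpiD opprD addrA => /le_lt_trans; apply; lra.
pose u n : D := nat_rect (fun=> D) 0 (fun n u => v (n, u)) n.
have uI n : Inv n (u n).
  elim: n => [|n IH]; last exact: (vP (n, u n) IH).1.
  by move=> t t01; rewrite cpi0 subr0 /g expr0 mulr1; exact: qr.
have uS n : rnorm (u n.+1 - u n) <= r * (1 / 2) ^+ n := (vP (n, u n) (uI n)).2.
have [l lu] := geo_cvg (ltW r0) q01 uS.
have {}lu n : bcnorm (l - u n) <= 2 * r * g n.
  by have := lu n; rewrite bc_rnormE ler_pdivlMr -/(g n); lra.
exists l; split.
  by have := lu 0%N; rewrite subr0 /g expr0 mulr1.
move=> t t01; apply/esym/subr0_eq/rnorm0_eq0/le_anti; rewrite rnorm_ge0 andbT.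
apply/ler_addgt0Pr => s s0; rewrite add0r.
have [n /ltW ns] := geo_small (3 * r) q01 s0; apply: le_trans ns; rewrite -/(g n).
have -> : q t - cpi I (l t) = q t - cpi I (u n t) - cpi I (l t - u n t).
  by rewrite cpiB opprB addrA subrK.
have := rnormB (q t - cpi I (u n t)) (cpi I (l t - u n t)).
have := qnorm_le I (l t - u n t); rewrite -cquot_rnormE.
have := bcnorm_ub (l - u n) t; rewrite [(l - u n) t]/=.
have := lu n; have := uI n t t01; lra.
Qed.

Lemma path_lift_from (q : R -> cquot I) (b : B) (r : R) : 0 < r ->
  (forall t, cont_at q t) -> (forall t, q (clamp t) = q t) ->
  (forall t, 0 <= t <= 1 -> rnorm (q t) < r) -> cpi I b = q 0 ->
  exists f : bcfun B [set: R], [/\ bcnorm f <= 4 * r + rnorm b, f 0 = b &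
    forall t, cpi I (f t) = q t].
Proof.
move=> r0 qc qcl qr bq; have [f [fr fq]] := path_lift r0 qc qr.
have b0 := rnorm_ge0 b.
pose h t := f (clamp t) - f 0 + b.
have hr t : rnorm (h t) <= 4 * r + rnorm b.
  have := rnormD (f (clamp t) - f 0) b; have := rnormB (f (clamp t)) (f 0).
  have := bcnorm_ub f (clamp t); have := bcnorm_ub f 0; rewrite /h; lra.
have hc : bc_set [set: R] h.
  split=> [|t _ s s0]; first by exists (4 * r + rnorm b).
  have /nbhs_distP[d d0 dP] := (bcfunP f).2 (clamp t) Logic.I _ s0.
  apply/nbhs_distP; exists d => // x tx /=.
  have -> : h t - h x = f (clamp t) - f (clamp x).
    by rewrite /h opprD addrACA subrr addr0 opprB addrA subrK.
  by apply: dP; exact: le_lt_trans (clamp_lip _ _) tx.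
exists (bc_mk hc); split=> [||t] /=.
- by apply: bcnorm_le => //; lra.
- by rewrite /h clamp_id ?lexx ?ler01// subrr add0r.
- rewrite /h cpiD cpiB !fq ?clamp_itv ?lexx ?ler01//.
  by rewrite bq subrK.
Qed.

End PathLifting.

(** * Local path-connectedness *)

Section LocalPaths.
Variables (R : realType) (T : topologicalType).

Definition joined (U : set T) (x y : T) := exists g : R -> T,
  [/\ continuous g, g 0 = x, g 1 = y & forall t, U (g t)].

Lemma continuous_lip (g : R -> T) (h : R -> R) (M : R) : continuous g -> 0 < M ->
  (forall t s, `|h t - h s| <= M * `|t - s|) -> continuous (g \o h).
Proof.
move=> gc M0 hM t U /gc/nbhs_distP[d d0 dU]; apply/nbhs_distP; exists (d / M).
  exact: divr_gt0.
move=> s; rewrite ltr_pdivlMr// mulrC => ts; apply: dU.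
exact: le_lt_trans (hM _ _) ts.
Qed.

Lemma joined_sym U x y : joined U x y -> joined U y x.
Proof.
move=> [g [gc g0 g1 gU]]; exists (g \o (fun t => 1 - t)); split=> [|||t] /=.
- apply: (continuous_lip gc ltr01) => t s.
  by rewrite mul1r (_ : _ - _ = s - t) 1?distrC//; lra.
- by rewrite subr0.
- by rewrite subrr.
- exact: gU.
Qed.

Lemma joined_sub U (g : R -> T) t : continuous g -> (forall t, U (g t)) ->
  joined U (g 0) (g t).
Proof.
move=> gc gU; exists (g \o (fun s => t * s)); split=> [|||s] /=.
- apply: (continuous_lip gc (_ : 0 < `|t| + 1)) => [|u v].
    by rewrite ltr_wpDl.
  by rewrite -mulrBr normrM ler_wpM2r// lerDl.
- by rewrite mulr0.
- by rewrite mulr1.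
- exact: gU.
Qed.

Lemma joined_trans U x y z : joined U x y -> joined U y z -> joined U x z.
Proof.
move=> [f [fc f0 f1 fU]] [g [gc g0 g1 gU]].
pose F := f \o (fun t => clamp (2 * t)); pose G := g \o (fun t => clamp (2 * t - 1)).
have Fc : continuous F.
  apply: (continuous_lip fc (ltr0Sn R 1)) => t s.
  by rewrite (le_trans (clamp_lip _ _))// -mulrBr normrM ger0_norm.
have Gc : continuous G.
  apply: (continuous_lip gc (ltr0Sn R 1)) => t s.
  rewrite (le_trans (clamp_lip _ _))// opprB addrA subrK -mulrBr normrM.
  by rewrite ger0_norm.
have FE t : 1 / 2 <= t -> F t = y by move=> t2; rewrite /F/= clamp_ge1//; lra.
have GE t : t <= 1 / 2 -> G t = y by move=> t2; rewrite /G/= clamp_le0//; lra.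
exists (fun t => if t <= 1 / 2 then F t else G t); split=> [t V|||t].
- have [t2|t2|t2] := ltgtP t (1 / 2) => HV.
  + have /nbhs_distP[d d0 dV] := Fc _ _ HV.
    apply/nbhs_distP; exists (Num.min d (1 / 2 - t)).
      by rewrite lt_min d0 subr_gt0.
    move=> s; rewrite lt_min => /andP[/dV Vs]; have := ler_norm (s - t).
    rewrite distrC => h1 h2 /=; rewrite ifT//; lra.
  + have /nbhs_distP[d d0 dV] := Gc _ _ HV.
    apply/nbhs_distP; exists (Num.min d (t - 1 / 2)).
      by rewrite lt_min d0 subr_gt0.
    move=> s; rewrite lt_min => /andP[/dV Vs]; have := ler_norm (t - s).
    by move=> h1 h2 /=; rewrite ifF//; apply/negbTE; rewrite -ltNge; lra.
  + have HG : nbhs (G t) V by move: HV; rewrite FE ?GE ?t2.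
    have FG : nbhs t (F @^-1` V `&` G @^-1` V).
      by apply: filterI; [exact: Fc|exact: Gc].
    by apply: filterS FG => s /= []; case: ifP.
- by rewrite ifT /F/=; [rewrite mulr0 clamp_id ?lexx ?ler01|lra].
- by rewrite ifF /G/=; [rewrite clamp_ge1//; lra|apply/negbTE; rewrite -ltNge; lra].
- by case: ifP => _; [exact: fU|exact: gU].
Qed.

Lemma locally_joined_lpc : (forall (x : T) (U : set T), nbhs x U ->
    nbhs x [set y | joined U x y]) -> locally_path_connected R T.
Proof.
move=> loc x U xU; pose V := [set y | joined U° x y].
have Uo y : U° y -> nbhs y U° by move=> Uy; exact: nbhs_interior.
exists V; split.
- apply/open_nbhsP => y xy; have Uy : U° y by case: xy => g [_ _ <- gU].
  by apply: filterS (loc _ _ (Uo _ Uy)) => z; exact: joined_trans.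
- exists (fun=> x); split=> // t; exact: cst_continuous.
- by move=> y [g [_ _ <- gU]]; exact: nbhs_singleton (gU 1).
- move=> y z xy xz; have [g [gc g0 g1 gU]] := joined_trans (joined_sym xy) xz.
  exists g; split=> //; first exact: continuous_subspaceT.
  move=> t _; apply: joined_trans xy _.
  by rewrite -g0; exact: joined_sub.
Qed.

End LocalPaths.

(** * Consequences of l-openness *)

Section LOpen.
Variables (R : realType) (A : cstarType R).

Lemma lift_near (B : cstarType R) (T : topologicalType) (K : set T)
    (J : T -> closedIdeal B) (Phi : starHom A (bcfun B K)) (s : A -> bcfun B K)
    (Psi : starHom A (cquot (fam_ideal K J))) :
  (forall a, Psi a = cpi (fam_ideal K J) (s a)) -> push_hom (fam_ideal K J) Phi = Psi ->
  forall a x, ideal_set (J x) (Phi a x - s a x).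
Proof.
move=> PsiE PhiE a; suff /cpiP : cpi (fam_ideal K J) (Phi a) = cpi _ (s a) by [].
by rewrite -PsiE -PhiE.
Qed.

Lemma open_map_lpc (B : cstarType R) :
  (forall (D : cstarType R) (I : closedIdeal D),
     open_map (fun phi : starHom A D => push_hom I phi)) ->
  locally_path_connected R (starHom A B).
Proof.
move=> Aopen; apply: locally_joined_lpc => phi U [F [e [e0 FU]]].
pose K := [set: R].
pose J (t : R) := if (t == 0) || (t == 1) then zero_ideal B else full_ideal B.
pose Phi0 : starHom A (bcfun B K) := bc_cst K phi.
pose V := (pointnorm_basic Phi0 F e)°.
have V0 : V Phi0 by exact: pointnorm_basic_nbhs.
have oV : open [set push_hom (fam_ideal K J) Phi | Phi in V].
  by apply: Aopen; exact: open_interior.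
have [|G [d [d0 Gd]]] := @glue_near _ _ _ K J _ Phi0 _ (open_nbhs_nbhs (conj oV _)).
  by exists Phi0.
apply: filterS (pointnorm_basic_nbhs phi G (divr_gt0 d0 ((ltr0Sn R 1)))) => psi.
move=> /pointnorm_basicP psiG.
pose s0 a t := phi a + (clamp t)%:C *: (psi a - phi a).
have s0K a : bc_set K (s0 a).
  split=> [|t _].
    exists (rnorm (phi a) + rnorm (psi a - phi a)) => t.
    have /andP[c0 c1] := clamp_itv t.
    rewrite (le_trans (rnormD _ _))// lerD2l rnormZ//.
    by rewrite ler_piMl// rnorm_ge0.
  apply: (@lip_cont _ _ _ (rnorm (psi a - phi a))) => u.
  rewrite opprD addrACA subrr add0r -scalerBl -rmorphB rnormZc mulrC.
  rewrite ler_wpM2l ?rnorm_ge0// normc_def/= expr0n addr0 sqrtr_sqr.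
  exact: clamp_lip.
pose s a : bcfun B K := bc_mk (s0K a).
have sE a : s a 0 = phi a /\ s a 1 = psi a.
  rewrite /s/= /s0 !clamp_id ?lexx ?ler01// scale0r addr0 scale1r.
  by rewrite addrC subrK.
have [t|a aG|Psi [Phi VPhi PhiE] PsiE] := Gd s.
- have [->|t0] := eqVneq t 0.
    by exists (push_hom (J 0) phi) => a; rewrite (sE a).1.
  have [->|t1] := eqVneq t 1.
    by exists (push_hom (J 1) psi) => a; rewrite (sE a).2.
  exists (push_hom (J t) phi) => a; apply/cpiP.
  by rewrite /J (negbTE t0) (negbTE t1).
- exists (s a - Phi0 a); last by move=> t; rewrite subrr; exact: ideal0.
  have /= := psiG a aG; set r := rnorm _ => rd.
  suff : bcnorm (s a - Phi0 a) <= r by move=> /le_lt_trans; apply; lra.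
  apply: bcnorm_le => [|t]; first exact: rnorm_ge0.
  have /andP[c0 c1] := clamp_itv t.
  have -> : (s a - Phi0 a) t = (clamp t)%:C *: (psi a - phi a).
    by rewrite -[LHS]/(s0 a t - phi a) /s0 addrC addKr.
  by rewrite rnormZ// ler_piMl// rnorm_ge0.
have end0 a t : (t == 0) || (t == 1) -> Phi a t = s a t.
  by move=> t01; have := lift_near PsiE PhiE a t; rewrite /J t01 => /subr0_eq.
exists (fun t => starhom_comp (bc_eval B K t) Phi); split.
- by apply: starHom_continuous => a t; exact: (bcfunP (Phi a)).2.
- by apply: starhomP => a /=; rewrite end0 ?eqxx// (sE a).1.
- by apply: starhomP => a /=; rewrite end0 ?eqxx ?orbT// (sE a).2.
- move=> t; apply: FU; apply/pointnorm_basicP => a aF.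
  have /pointnorm_basicP/(_ a aF) := pointnorm_singleton VPhi.
  apply: le_lt_trans; rewrite bc_rnormE.
  exact: (bcnorm_ub (Phi a - Phi0 a) t).
Qed.

Hypothesis A_lopen : l_open A.

Lemma l_open_near (B : cstarType R) (I : closedIdeal B) (phi : starHom A B) :
  nbhs (push_hom I phi) (@liftable R A B I).
Proof.
have /open_nbhsP oL := @A_lopen B I.
by apply: oL; exists phi.
Qed.

Lemma l_open_open_map (B : cstarType R) (I : closedIdeal B) :
  open_map (fun phi : starHom A B => push_hom I phi).
Proof.
move=> V oV; apply/open_nbhsP => _ [phi Vphi <-].
pose T := starHom A (cquot I); pose x0 : T := push_hom I phi; pose K := [set x0].
pose J x := if `[< x = x0 >] then zero_ideal B else I.
have J0 : J x0 = zero_ideal B by rewrite /J asboolT.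
have JN x : x <> x0 -> J x = I by move=> xx0; rewrite /J asboolF.
have [sec secP] := bounded_section I.
have sec0 : sec 0 = 0.
  have [_] := secP 0; rewrite rnorm0 mulr0 => s0; apply/rnorm0_eq0/le_anti.
  by rewrite s0 rnorm_ge0.
pose Phi0 : starHom A (bcfun B K) := bc_cst K phi.
have [G [d [d0 Gd]]] := glue_near (@l_open_near _ (fam_ideal K J) Phi0).
have d4 : 0 < d / 4 by lra.
pose U := pointnorm_basic x0 G (d / 4).
pose h x : T := if `[< U x >] then x else x0.
have hU x : U (h x).
  rewrite /h; case: asboolP => // _; exact: pointnorm_basic_refl.
have h0 : h x0 = x0 by rewrite /h; case: asboolP.
have hle x a : rnorm (h x a - x0 a) <= rnorm (x a - x0 a).
  by rewrite /h; case: asboolP => // _; rewrite subrr rnorm0 rnorm_ge0.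
pose s0 a x := phi a + sec (h x a - x0 a).
have s00 a : s0 a x0 = phi a by rewrite /s0 h0 subrr sec0 addr0.
have s0K a : bc_set K (s0 a).
  split=> [|_ -> r r0].
    exists (rnorm (phi a) + 4 * rnorm a) => x; rewrite (le_trans (rnormD _ _))// lerD2l.
    have := (secP (h x a - x0 a)).2; have := rnormB (h x a) (x0 a).
    have := starhom_norm (h x) a; have := starhom_norm x0 a; lra.
  have r2 : 0 < r / 2 by lra.
  apply: filterS (pointnorm_basic_nbhs x0 [:: a] r2) => x /pointnorm_basicP.
  move=> /(_ a (mem_head _ _)) xr /=; rewrite s00 rnormC /s0 addrC addKr.
  by have := (secP (h x a - x0 a)).2; have := hle x a; lra.
pose s a : bcfun B K := bc_mk (s0K a).
have [x|a aG|Psi [Phi PhiE] PsiE] := Gd s.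
- have [->|xx0] := pselect (x = x0).
    by exists (push_hom (J x0) phi) => a; rewrite [s a x0]s00.
  rewrite JN//; exists (h x) => a; rewrite cpiD (secP _).1.
  by rewrite -[cpi I (phi a)]/(x0 a) addrC subrK.
- exists (s a - Phi0 a); last by move=> t; rewrite subrr; exact: ideal0.
  suff : bcnorm (s a - Phi0 a) <= d / 2 by move=> /le_lt_trans; apply; lra.
  apply: bcnorm_le => [|x]; first lra.
  have -> : (s a - Phi0 a) x = sec (h x a - x0 a).
    by rewrite -[LHS]/(s0 a x - phi a) /s0 addrC addKr.
  have /pointnorm_basicP/(_ a aG) := hU x.
  by have := (secP (h x a - x0 a)).2; lra.
have PhiJ := lift_near PsiE (esym PhiE).
pose ev x := starhom_comp (bc_eval B K x) Phi.
have ev0 : ev x0 = phi.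
  apply: starhomP => a; have := PhiJ a x0; rewrite J0 => /subr0_eq.
  by rewrite [s a x0]s00.
have evc : nbhs x0 [set x | V (ev x)].
  apply: starHom_cvg => [a|]; first exact: (bcfunP (Phi a)).2.
  by rewrite ev0; move/open_nbhsP: oV; apply.
apply: filterS (filterI evc (pointnorm_basic_nbhs x0 G d4)) => x /= [Vx Ux].
have [->|xx0] := pselect (x = x0); first by exists phi.
exists (ev x) => //; apply: starhomP => a.
have := PhiJ a x; rewrite JN// => /cpiP /= ->.
by rewrite cpiD (secP _).1 -[cpi I (phi a)]/(x0 a) addrC subrK /h asboolT.
Qed.

Lemma l_open_closed (B : cstarType R) (I : closedIdeal B) : closed (@liftable R A B I).
Proof.
move=> phi phiL; pose T := starHom A (cquot I); pose K : set T := set0.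
have [sec secP] := bounded_section I.
have /choice[l lP] : forall x : T, exists psi : starHom A B,
    liftable x -> x = push_hom I psi.
  move=> x; have [[psi xpsi]|xN] := pselect (liftable x); first by exists psi.
  by exists (starhom0 A B).
have lK a : bc_set K (fun x => l x a).
  by split=> // ; exists (rnorm a) => x; exact: starhom_norm.
pose J (x : T) := I; pose Phi0 := bc_hom lK.
have [G [d [d0 Gd]]] := glue_near (@l_open_near _ (fam_ideal K J) Phi0).
have d4 : 0 < d / 4 by lra.
pose U := pointnorm_basic phi G (d / 4).
pose h x : T := if `[< U x /\ liftable x >] then phi else push_hom I (l x).
have hG a x : a \in G -> rnorm (h x a - push_hom I (l x) a) < d / 4.
  move=> aG; rewrite /h; case: asboolP => [[Ux Lx]|_].
    by rewrite -(lP x Lx) rnormC; move/pointnorm_basicP: Ux; apply.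
  by rewrite subrr rnorm0.
pose s0 a x := l x a + sec (h x a - push_hom I (l x) a).
have s0K a : bc_set K (s0 a).
  split=> //; exists (5 * rnorm a) => x; rewrite (le_trans (rnormD _ _))//.
  have := (secP (h x a - push_hom I (l x) a)).2.
  have := rnormB (h x a) (push_hom I (l x) a).
  have := starhom_norm (h x) a; have := starhom_norm (push_hom I (l x)) a.
  by have := starhom_norm (l x) a; lra.
pose s a : bcfun B K := bc_mk (s0K a).
have sE a x : cpi I (s a x) = h x a.
  by rewrite cpiD (secP _).1 -[cpi I (l x a)]/(push_hom I (l x) a) addrC subrK.
have [x|a aG|Psi [Phi PhiE] PsiE] := Gd s.
- by exists (h x) => a; rewrite sE.
- exists (s a - Phi0 a); last by move=> t; rewrite subrr; exact: ideal0.
  suff : bcnorm (s a - Phi0 a) <= d / 2 by move=> /le_lt_trans; apply; lra.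
  apply: bcnorm_le => [|x]; first lra.
  have -> : (s a - Phi0 a) x = sec (h x a - push_hom I (l x) a).
    by rewrite -[LHS]/(s0 a x - l x a) /s0 addrC addKr.
  by have := hG a x aG; have := (secP (h x a - push_hom I (l x) a)).2; lra.
have [x [Lx Ux]] := phiL U (pointnorm_basic_nbhs phi G d4).
exists (starhom_comp (bc_eval B K x) Phi); apply: starhomP => a.
have /cpiP := lift_near PsiE (esym PhiE) a x.
by rewrite /J sE /h asboolT.
Qed.

Lemma l_open_homotopy_lifting : homotopy_lifting A.
Proof.
move=> B I phi phi0 phic phi0E; pose p t := phi (clamp t).
pose K := [set: R]; pose J (t : R) := if t == 0 then zero_ideal B else I.
have pc a t : cont_at (fun t => p t a) t.
  move=> r r0; have := path_on_clamp phic (pointnorm_basic_nbhs (p t) [:: a] r0).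
  apply: filterS => s /pointnorm_basicP/(_ a (mem_head _ _)).
  by rewrite rnormC.
have p0 a : p 0 a = cpi I (phi0 a) by rewrite /p clamp_id ?lexx ?ler01// phi0E.
have ppc k a t : cont_at (fun t => p (k * clamp t) a) t.
  move=> r r0; have /nbhs_distP[d d0 dP] := pc a (k * clamp t) _ r0.
  have k1 : 0 < `|k| + 1 by rewrite ltr_wpDl.
  apply/nbhs_distP; exists (d / (`|k| + 1)); first exact: divr_gt0.
  move=> s; rewrite ltr_pdivlMr// => ts; apply: dP; rewrite -mulrBr normrM.
  have := clamp_lip t s; have := normr_ge0 k; have := normr_ge0 (clamp t - clamp s).
  nra.
have clampK t : clamp (clamp t) = clamp t by rewrite clamp_id// clamp_itv.
have /choice[s sP] : forall ka : R * A, exists f : bcfun B K, f 0 = phi0 ka.2 /\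
    forall t, cpi I (f t) = p (ka.1 * clamp t) ka.2.
  move=> [k a]/=; have r0 : 0 < rnorm a + 1 by rewrite ltr_wpDl ?rnorm_ge0.
  have [|t|t t01||f [_ f0 fp]] :=
    @path_lift_from _ _ I (fun t => p (k * clamp t) a) (phi0 a) _ r0.
  - exact: ppc.
  - by rewrite clampK.
  - by have := starhom_norm (p (k * clamp t)) a; lra.
  - by rewrite clamp_id ?lexx ?ler01// mulr0 p0.
  by exists f.
have /choice[Psi PsiE] : forall k,
    exists Psi : starHom A (cquot (fam_ideal K J)), forall a,
    Psi a = cpi (fam_ideal K J) (s (k, a)).
  move=> k; apply: (glue_hom (s := fun a => s (k, a))) => t; have [->|t0] := eqVneq t 0.
    by exists (push_hom (J 0) phi0) => a; rewrite (sP (k, a)).1.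
  rewrite /J (negbTE t0); exists (p (k * clamp t)) => a.
  by rewrite (sP (k, a)).2.
have Psic : continuous Psi.
  apply: starHom_continuous => a k r r0; have r8 : 0 < r / 8 by lra.
  have [d d0 dP] := unif_cont r8 (pc a).
  apply/nbhs_distP; exists d => // k' kk' /=.
  have q8 t : rnorm (p (k * clamp t) a - p (k' * clamp t) a) < r / 8.
    have pE x : p x = p (clamp x) by rewrite /p clampK.
    rewrite (pE (k * _)) (pE (k' * _)); apply: dP; first exact: clamp_itv.
    apply: le_lt_trans (clamp_lip _ _) _; rewrite -mulrBl normrM.
    apply: le_lt_trans kk'; rewrite ler_piMr//.
    by have /andP[c0 c1] := clamp_itv t; rewrite ger0_norm.
  have [|t|||g [gr g0 gq]] := @path_lift_from _ _ I
    (fun t => p (k * clamp t) a - p (k' * clamp t) a) 0 _ r8.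
  - move=> t; apply: (@cont_atD _ _ _ (fun t => p (k * clamp t) a)); first exact: ppc.
    by move=> e /(ppc k' a t); apply: filterS => u /=; rewrite -opprD rnormN.
  - by rewrite clampK.
  - by move=> t _.
  - by rewrite clamp_id ?lexx ?ler01// !mulr0 subrr cpi0.
  rewrite !PsiE -cpiB.
  have -> : cpi (fam_ideal K J) (s (k, a) - s (k', a)) = cpi _ g.
    apply/cpiP => t; rewrite /J; have [->|t0] := eqVneq t 0.
      suff : s (k, a) 0 - s (k', a) 0 - g 0 = 0 by [].
      by rewrite g0 (sP (k, a)).1 (sP (k', a)).1 subr0 subrr.
    by apply/cpiP; rewrite gq cpiB (sP (k, a)).2 (sP (k', a)).2.
  rewrite cquot_rnormE; apply: le_lt_trans (qnorm_le _ _) _; rewrite bc_rnormE.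
  by apply: le_lt_trans gr _; rewrite rnorm0; lra.
have L1 : liftable (Psi 1).
  apply: (@clopen_real R [set k | liftable (Psi k)]).
  - exists (bc_cst K phi0); apply: starhomP => a; rewrite PsiE; apply/cpiP => t.
    rewrite /J; have [->|t0] := eqVneq t 0.
      suff : s (0, a) 0 - phi0 a = 0 by [].
      by rewrite (sP (0, a)).1 subrr.
    by apply/cpiP; rewrite (sP (0, a)).2 mul0r p0.
  - move=> k Lk; apply: Psic.
    by have /open_nbhsP oL := @A_lopen _ (fam_ideal K J); exact: oL.
  - move=> k kL; apply: l_open_closed => V /Psic/kL[k' [Lk' Vk']].
    by exists (Psi k').
have [Phi PhiE] := L1.
have PhiJ := lift_near (PsiE 1) (esym PhiE).
exists (fun t => starhom_comp (bc_eval B K t) Phi); split.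
- apply: continuous_subspaceT; apply: starHom_continuous => a t.
  exact: (bcfunP (Phi a)).2.
- apply: starhomP => a; have := PhiJ a 0; rewrite /J eqxx => /subr0_eq.
  by rewrite (sP (1, a)).1.
- move=> t t01; apply: starhomP => a; symmetry.
  have : ideal_set I (Phi a t - s (1, a) t).
    have := PhiJ a t; rewrite /J; case: eqP => // _ ->; exact: ideal0.
  move=> /cpiP/= ->; rewrite (sP (1, a)).2 /p mul1r.
  by rewrite clampK clamp_id.
Qed.

End LOpen.

Lemma homotopy_lifting_l_open (R : realType) (A : cstarType R) :
  homotopy_lifting A ->
  (forall B : cstarType R, locally_path_connected R (starHom A B)) ->
  l_open A.
Proof.
move=> hl lpc B I; apply/open_nbhsP => _ [phi0 ->].
have [V [/open_nbhsP oV V0 _ Vp]] := lpc _ (push_hom I phi0) setT filterT.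
apply: filterS (oV _ V0) => psi Vpsi; have [g [gc g0 g1 _]] := Vp _ _ V0 Vpsi.
have [h [_ _ hg]] := hl B I g phi0 gc g0.
by exists (h 1); rewrite -g1; apply: hg; rewrite ler01 lexx.
Qed.

Theorem theorem1p1 (R : realType) (A : cstarType R) :
  (l_open A <->
   forall (B : cstarType R) (I : closedIdeal B),
     open_map (fun phi : starHom A B => push_hom I phi)) /\
  ((forall (B : cstarType R) (I : closedIdeal B),
     open_map (fun phi : starHom A B => push_hom I phi)) <->
   homotopy_lifting A /\
   forall B : cstarType R, locally_path_connected R (starHom A B)).
Proof.
have lo : (forall (B : cstarType R) (I : closedIdeal B),
    open_map (fun phi : starHom A B => push_hom I phi)) -> l_open A.
  move=> Aopen B I; have := Aopen B I setT openT; congr open.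
  by apply/seteqP; split=> psi [phi]; [move=> _ <-|move=> ->]; exists phi.
split; first by split=> // lA B I; exact: l_open_open_map.
split=> [Aopen|[hl lpc] B I].
  split=> [|B]; last exact: open_map_lpc.
  by apply: l_open_homotopy_lifting; exact: lo.
by apply: l_open_open_map; exact: homotopy_lifting_l_open.
Qed.
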